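(* There is a function $\varepsilon_d$ with $\varepsilon_d\to0$ as $d\to\infty$ such that for $\varepsilon_d\leq\varepsilon\leq1-\varepsilon_d$ and $k=(1+\varepsilon)\frac{\ln d}{d}\cdot n$, with high probability a pair $(G,\sigma)$ chosen from $\mathcal{U}_k(n,m)$ is not $(\gamma,\delta)$-expandable for any $\gamma>\varepsilon_d$ and $$\delta<\gamma+\frac{2(\varepsilon-\varepsilon_d)}{1+\varepsilon}.$$
   Context: $G(n,m)$ is the random graph on $V=\{1,\dots,n\}$ with $m$ edges chosen uniformly without replacement; $d=2m/n$ is fixed as $n\to\infty$. ''With high probability'' means with probability tending to $1$ as $n\to\infty$. $\mathcal{S}_k(G)$ is the set of independent sets of size exactly $k$ in $G$, and $\alpha(G)$ the independence number. $\Lambda_k(n,m)$ is the set of pairs $(G,\sigma)$ with $G$ a graph on $V$ with $m$ edges and $\sigma$ an independent set of $G$ of size $k$. $\mathcal{U}_k(n,m)$ is the distribution on $\Lambda_k(n,m)$ given by: choose $G=G(n,m)$; if $\alpha(G)\geq k$, choose $\sigma\in\mathcal{S}_k(G)$ uniformly at random. For $\gamma,\delta\geq0$, a pair $(G,\sigma)$ is $(\gamma,\delta)$-expandable if $G$ has an independent set $\tau$ with $|\tau|\geq(1+\gamma)|\sigma|$ and $|\tau\cap\sigma|\geq(1-\delta)|\sigma|$. *)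

(* Defs.v *)
From HB Require Import structures.
From mathcomp Require Import all_boot all_order all_algebra.
From mathcomp Require Import all_classical all_reals all_analysis.
Set Implicit Arguments. Unset Strict Implicit. Unset Printing Implicit Defensive.
Import Order.TTheory GRing.Theory Num.Theory.
Local Open Scope ring_scope.

Definition is_graph (n : nat) (E : {set {set 'I_n}}) : bool :=
  [forall e in E, #|e| == 2%N].

Definition graphs_nm (n m : nat) : {set {set {set 'I_n}}} :=
  [set E | is_graph E & #|E| == m].

Definition independent (n : nat) (E : {set {set 'I_n}}) (S : {set 'I_n}) : bool :=
  [forall e in E, ~~ (e \subset S)].

Definition indep_k (n : nat) (E : {set {set 'I_n}}) (k : nat) : {set {set 'I_n}} :=
  [set S | independent E S & #|S| == k].

Definition expandable (R : realType) (n : nat) (E : {set {set 'I_n}})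
    (sigma : {set 'I_n}) (gamma delta : R) : Prop :=
  exists tau : {set 'I_n}, independent E tau /\
    (1 + gamma) * #|sigma|%:R <= #|tau|%:R /\
    (1 - delta) * #|sigma|%:R <= #|tau :&: sigma|%:R.

(* Probability, under U_k(n,m), that the random pair (G,sigma) is defined
   (i.e. alpha(G) >= k) AND satisfies P.  Graphs with alpha(G) < k
   contribute 0 (counted as failure of the event). *)
Definition probU (R : realType) (n m k : nat)
    (P : {set {set 'I_n}} -> {set 'I_n} -> bool) : R :=
  \sum_(E in graphs_nm n m)
     (#|graphs_nm n m|%:R^-1 *
      (if (0 < #|indep_k E k|)%N then
         #|[set S in indep_k E k | P E S]|%:R / #|indep_k E k|%:R
       else 0)).

(* Main.v *)
(** Write k = kap (ln d / d) n with kap = 1 + eps, and let M be the expected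
    number of independent sets of size k.  If |S_k(G)| >= a with high
    probability, then the bad event has probability at most o(1) plus
    E #(bad pairs (G, sigma)) / a.

    For a fixed sigma, a union bound over tau with r = |tau \ sigma| costs
    exp (r ln d) choices and gains exp (- (d/2n) r (|tau| + |tau & sigma|));
    the condition on delta says exactly that the second exponent wins, by
    exp (- eps_d^2 k ln d / 2).  Hence |S_k(G)| >= M exp (- c eps_d^2 k ln d)
    with a small constant c suffices, which leaves room for constant factors to
    the power k because eps_d^2 ln d is large.

    That bound is proved in G(n,p).  Cut the vertices into K = (1 + zeta) k
    classes and count the independent sets with one vertex in each class.  A
    second moment computation shows that this number is at least half its mean
    with probability at least exp (- zeta^2 k / 128) / 4.  Exposing the graph
    class by class, the Hamming distance to this event is 1-Lipschitz in each of
    the K independent coordinates, so it exceeds zeta k with much smaller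
    probability; deleting the vertices of the zeta k exceptional classes then
    leaves independent sets of size k in the graph itself. *)

Require Import Defs.
From HB Require Import structures.
From mathcomp Require Import all_boot all_order all_algebra.
From mathcomp Require Import all_classical all_reals all_analysis.
From mathcomp Require Import zify ring lra.
From mathcomp Require Import finset.
Import Order.TTheory GRing.Theory Num.Theory.
Import numFieldNormedType.Exports.
Set Implicit Arguments. Unset Strict Implicit. Unset Printing Implicit Defensive.
Local Open Scope ring_scope.

(** * Binomial random subsets *)

(* Expectation of [f] over the random subset of [es] keeping each element
   independently with probability [p]. *)
Fixpoint bexp (R : realType) (T : finType) (p : R) (es : seq T)
    (f : {set T} -> R) : R :=
  if es is e :: es' then
    (1 - p) * bexp p es' f + p * bexp p es' (fun S => f (e |: S))
  else f set0.

Lemma bexp_ext_sub (R : realType) (T : finType) (p : R) (es : seq T)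
    (f g : {set T} -> R) :
  (forall S : {set T}, {subset S <= es} -> f S = g S) ->
  bexp p es f = bexp p es g.
Proof.
elim: es f g => [|e es IH] f g fg /=.
  by apply: fg => x; rewrite inE.
congr (_ * _ + _ * _); apply: IH => S sS; apply: fg => x.
  by move=> /sS xs; rewrite inE xs orbT.
by rewrite !inE => /orP[->//|/sS ->]; rewrite orbT.
Qed.

Lemma bexp_ext (R : realType) (T : finType) (p : R) (es : seq T)
    (f g : {set T} -> R) : f =1 g -> bexp p es f = bexp p es g.
Proof. by move=> fg; apply: bexp_ext_sub => S _. Qed.

Lemma ler_bexp (R : realType) (T : finType) (p : R) (es : seq T)
    (f g : {set T} -> R) : 0 <= p <= 1 ->
  (forall S : {set T}, {subset S <= es} -> f S <= g S) ->
  bexp p es f <= bexp p es g.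
Proof.
move=> /andP[p0 p1]; elim: es f g => [|e es IH] f g fg /=.
  by apply: fg => x; rewrite inE.
apply: lerD; apply: ler_wpM2l => //; rewrite ?subr_ge0//; apply: IH => S sS; apply: fg => x.
  by move=> /sS xs; rewrite inE xs orbT.
by rewrite !inE => /orP[->//|/sS ->]; rewrite orbT.
Qed.

Lemma bexpD (R : realType) (T : finType) (p : R) (es : seq T)
    (f g : {set T} -> R) :
  bexp p es (fun S => f S + g S) = bexp p es f + bexp p es g.
Proof. by elim: es f g => [|e es IH] f g //=; rewrite !IH; ring. Qed.

Lemma bexpZ (R : realType) (T : finType) (p c : R) (es : seq T)
    (f : {set T} -> R) :
  bexp p es (fun S => c * f S) = c * bexp p es f.
Proof. by elim: es f => [|e es IH] f //=; rewrite !IH; ring. Qed.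

Lemma bexp_const (R : realType) (T : finType) (p c : R) (es : seq T) :
  bexp p es (fun=> c) = c.
Proof. by elim: es => [|e es IH] //=; rewrite IH; ring. Qed.

Lemma bexp_sum (R : realType) (T : finType) (p : R) (es : seq T)
    (I : Type) (r : seq I) (P : pred I) (f : I -> {set T} -> R) :
  bexp p es (fun S => \sum_(i <- r | P i) f i S) =
  \sum_(i <- r | P i) bexp p es (f i).
Proof.
elim: es f => [|e es IH] f //=.
by rewrite !IH !mulr_sumr -big_split.
Qed.

Lemma bexp_cat (R : realType) (T : finType) (p : R) (s t : seq T)
    (f : {set T} -> R) :
  bexp p (s ++ t) f = bexp p s (fun S => bexp p t (fun S' => f (S :|: S'))).
Proof.
elim: s f => [|e s IH] f /=.
  by apply: bexp_ext => S; rewrite set0U.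
rewrite !IH; congr (_ + _ * _); apply: bexp_ext => S.
by apply: bexp_ext => S'; rewrite setUA.
Qed.

(** Every element of [F] must be rejected, and the others are irrelevant. With [F] a set of vertex
    pairs this is the probability that given vertex sets are independent. *)
Lemma bexp_avoid (R : realType) (T : finType) (p : R) (es : seq T)
    (F : {set T}) : uniq es -> {subset F <= es} ->
  bexp p es (fun S => [disjoint S & F]%:R) = (1 - p) ^+ #|F|.
Proof.
elim: es F => [|e es IH] F /=.
  move=> _ sF; have -> : F = set0.
    by apply/setP => x; rewrite in_set0; apply/negbTE/negP => /sF.
  by rewrite -setI_eq0 setI0 eqxx cards0.
move=> /andP[ees ues] sF; case: (boolP (e \in F)) => eF.
  have -> : bexp p es (fun S => [disjoint e |: S & F]%:R) = 0.
    rewrite -(bexp_const p 0 es); apply: bexp_ext => S.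
    rewrite (_ : [disjoint _ & _] = false) //.
    by apply/negP => /disjointFr/(_ (setU11 e S)); rewrite eF.
  rewrite mulr0 addr0 (cardsD1 e) eF add1n exprS; congr (_ * _).
  rewrite -IH//; last first.
    by move=> x; rewrite !inE => /andP[xe /sF]; rewrite inE (negbTE xe).
  apply: bexp_ext_sub => S sS; congr (_%:R); congr (nat_of_bool _).
  have eS : e \notin S by apply: contra ees => /sS.
  by rewrite -!setI_eq0 setIDA [_ :\ _]setDE -setIA
   [_ :&: ~: _]setIC setIA -setDE; congr (_ == _); apply/setP => x; rewrite !inE;
   case: eqP => // ->; rewrite (negbTE eS).
have sF' : {subset F <= es}.
  move=> x xF; move: (sF _ xF); rewrite inE => /orP[/eqP xe|//].
  by rewrite -xe xF in eF.
rewrite (bexp_ext _ _ (f := fun S => [disjoint e |: S & F]%:R)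
                  (g := fun S => [disjoint S & F]%:R)).
  by rewrite IH//; ring.
move=> S; congr (_%:R); congr (nat_of_bool _).
rewrite -!setI_eq0; congr (_ == _); apply/setP => x; rewrite !inE.
by case: eqP => // ->; rewrite (negbTE eF) !andbF.
Qed.

Lemma bexp_exp_card (R : realType) (T : finType) (p z : R) (es : seq T) :
  uniq es ->
  bexp p es (fun S => z ^+ #|S|) = (1 - p + p * z) ^+ size es.
Proof.
elim: es => [|e es IH] /=; first by rewrite cards0.
move=> /andP[ees ues].
rewrite (bexp_ext_sub _ (f := fun S => z ^+ #|e |: S|) (g := fun S => z * z ^+ #|S|)).
  by rewrite bexpZ IH // exprS; ring.
move=> S sS; rewrite cardsU1 (_ : e \notin S) ?add1n ?exprS//.
by apply: contra ees => /sS.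
Qed.

(** The explicit weights show that the order of [es] does not matter and make it possible to sort
    subsets by size. *)
Lemma bexpE (R : realType) (T : finType) (p : R) (es : seq T)
    (f : {set T} -> R) : uniq es ->
  bexp p es f =
  \sum_(S : {set T} | S \subset es) p ^+ #|S| * (1 - p) ^+ (size es - #|S|) * f S.
Proof.
elim: es f => [|e es IH] f /=.
  move=> _; rewrite (big_pred1 set0); first by rewrite cards0 !mul1r.
  move=> S; rewrite /= -subset0; apply/idP/idP => /fintype.subsetP h;
    by apply/fintype.subsetP => x /h; rewrite ?inE.
move=> /andP[ees ues]; rewrite !IH// [RHS](bigID (fun S : {set T} => e \in S)) /=.
rewrite [RHS]addrC !mulr_sumr.
have sz (S : {set T}) : S \subset es -> (#|S| <= size es)%N.
  by move=> sS; rewrite -(card_uniqP ues); apply: subset_leq_card.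
congr (_ + _).
  apply: eq_big => [S|S sS].
    apply/idP/andP => [sS|[sS eS]].
      split; last by apply: contra ees => /(fintype.subsetP sS).
      by apply/fintype.subsetP => x /(fintype.subsetP sS); rewrite inE => ->; rewrite orbT.
    apply/fintype.subsetP => x xS; move: (fintype.subsetP sS _ xS).
    rewrite inE => /orP[/eqP xe|//].
    by rewrite -xe xS in eS.
  rewrite subSn ?sz// exprS; ring.
rewrite [RHS](reindex_onto (fun S => e |: S) (fun S => S :\ e)) /=; last first.
  by move=> S /andP[_ eS]; rewrite setD1K.
apply: eq_big => [S|S sS].
  rewrite setU11 andbT; apply/idP/andP => [sS|[sS /eqP eS]].
    split; last by rewrite setU1K//; apply: contra ees => /(fintype.subsetP sS).
    by apply/fintype.subsetP => x; rewrite !inE => /orP[->//|/(fintype.subsetP sS) ->]; rewrite orbT.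
  rewrite -eS; apply/fintype.subsetP => x; rewrite !inE => /andP[xe /orP[|xS]].
    by rewrite (negbTE xe).
  by move: (fintype.subsetP sS x); rewrite !inE xS orbT (negbTE xe) => /(_ isT).
rewrite cardsU1 (_ : e \notin S) ?add1n ?subSS ?exprS; first ring.
by apply: contra ees => /(fintype.subsetP sS).
Qed.

(* Symmetrising over an independent copy turns the product of the two moments
   into an average of [cosh (theta * (f S - f S'))], so no mean or martingale
   is needed. *)
Lemma bexp_moments (R : realType) (T : finType) (p u : R) (ls : seq (seq T))
    (f : {set T} -> nat) : 0 <= p <= 1 -> 1 <= u ->
  (forall l (S S1 S2 : {set T}), l \in ls -> S1 \subset l -> S2 \subset l ->
     (f (S :|: S1) <= (f (S :|: S2)).+1)%N) ->
  bexp p (flatten ls) (fun S => u ^+ f S) *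
  bexp p (flatten ls) (fun S => u ^- f S) <= ((u + u^-1) / 2) ^+ size ls.
Proof.
move=> p01 u1; have u0 : 0 < u by apply: lt_le_trans u1.
have un0 : u != 0 by rewrite gt_eqF.
elim: ls f => [|l ls IH] f fL /=.
  by rewrite mulfV// expf_neq0.
rewrite !bexp_cat.
set A := fun S => bexp p (flatten ls) (fun S' => u ^+ f (S :|: S')).
set B := fun S => bexp p (flatten ls) (fun S' => u ^- f (S :|: S')).
set K := ((u + u^-1) / 2) ^+ size ls.
rewrite -/(bexp p l A) -/(bexp p l B).
have -> : bexp p l A * bexp p l B =
    2^-1 * bexp p l (fun S => bexp p l (fun S' => A S * B S' + A S' * B S)).
  have -> : bexp p l (fun S => bexp p l (fun S' => A S * B S' + A S' * B S)) =
     bexp p l A * bexp p l B + bexp p l A * bexp p l B.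
    rewrite (bexp_ext _ _ (g := fun S => bexp p l B * A S + bexp p l A * B S)).
      by rewrite bexpD !bexpZ; ring.
    move=> S; rewrite bexpD bexpZ; congr (_ + _); first by rewrite mulrC.
    rewrite (bexp_ext _ _ (g := fun S' => B S * A S')); first by rewrite bexpZ mulrC.
    by move=> S'; rewrite mulrC.
  by field.
(* With the first block fixed, the induction hypothesis treats the remaining blocks. *)
have ab S : A S * B S <= K.
  apply: IH => l' S' S1 S2 l'ls s1 s2; rewrite !setUA; apply: (fL l') => //.
  by rewrite inE l'ls orbT.
have pos (g : {set T} -> R) s : (forall S, 0 < g S) -> 0 < bexp p s g.
  move=> g0; elim: s g g0 => [|e s IHs] g g0 //=.
  move: p01 => /andP[p0 p1]; have h1 := IHs g g0; have h2 := IHs _ (fun S => g0 (e |: S)).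
  have [pE|pn1] := eqVneq p 1; first by rewrite pE subrr mul0r add0r mul1r -pE.
  apply: ltr_wpDr; first exact: mulr_ge0 p0 (ltW h2).
  by rewrite mulr_gt0// subr_gt0 lt_neqAle pn1.
have A0 S : 0 < A S by apply: pos => S'; rewrite exprn_gt0.
have B0 S : 0 < B S by apply: pos => S'; rewrite invr_gt0 exprn_gt0.
have AL (S S' : {set T}) : S \subset l -> S' \subset l -> A S <= u * A S'.
  move=> sS sS'; rewrite /A -bexpZ; apply: ler_bexp => // S'' _.
  rewrite -exprS ler_weXn2l//.
  by rewrite setUC [S' :|: _]setUC; apply: (fL l) => //; rewrite inE eqxx.
have key (S S' : {set T}) : {subset S <= l} -> {subset S' <= l} ->
    A S * B S' + A S' * B S <= (u + u^-1) * K.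
  (* The Lipschitz condition confines the ratio [x] to [1/u, u], and there x + 1/x is at most u +
     1/u. *)
  move=> /fintype.subsetP sS /fintype.subsetP sS'; set x := A S / A S'.
  have x0 : 0 < x by rewrite divr_gt0.
  have E : A S * B S' + A S' * B S = x * (A S' * B S') + x^-1 * (A S * B S).
    by rewrite /x; field; rewrite !gt_eqF.
  rewrite E; have xu : x <= u by rewrite ler_pdivrMr// AL.
  have xu' : x^-1 <= u by rewrite /x invf_div ler_pdivrMr// AL.
  have h1 : x * (A S' * B S') <= x * K by rewrite ler_pM2l// ab.
  have h2 : x^-1 * (A S * B S) <= x^-1 * K by rewrite ler_pM2l ?invr_gt0// ab.
  apply: (le_trans (lerD h1 h2)); rewrite -mulrDl ler_wpM2r//.
    by rewrite exprn_ge0// divr_ge0// addr_ge0// ?invr_ge0 ltW.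
  rewrite -subr_ge0; have -> : u + u^-1 - (x + x^-1) = (u - x) * (u - x^-1) / u.
    by field; rewrite un0 gt_eqF.
  by rewrite mulr_ge0 ?mulr_ge0 ?subr_ge0// invr_ge0 ltW.
rewrite exprS -/K; have -> : (u + u^-1) / 2 * K = 2^-1 * ((u + u^-1) * K) by ring.
rewrite ler_pM2l ?invr_gt0//.
rewrite -[leRHS](bexp_const p _ l); apply: ler_bexp => // S sS.
rewrite -[leRHS](bexp_const p _ l); apply: ler_bexp => // S' sS'.
exact: key.
Qed.

(** * Isoperimetry and transfer to uniform subsets *)

(** The two exponentials are at most 1/(1-t) and 1/(1+t), whose mean is 1/(1-t^2). For t^2 <= 1/2
    this is at most 1 + 2t^2. *)
Lemma cosh_le_expR_sqr (R : realType) (t : R) : t ^+ 2 <= 2^-1 ->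
  (expR t + (expR t)^-1) / 2 <= expR (2 * t ^+ 2).
Proof.
move=> t2; have t1 : -1 < t < 1 by apply/andP; split; nra.
have /andP[tl tu] := t1.
have h1 : expR t <= (1 - t)^-1.
  rewrite -[expR t]invrK -expRN lef_pV2 ?posrE ?expR_gt0 ?subr_gt0//.
  by apply: le_trans (expR_ge1Dx _).
have h2 : (expR t)^-1 <= (1 + t)^-1.
  by rewrite lef_pV2 ?posrE ?expR_gt0 ?expR_ge1Dx//; lra.
apply: (le_trans _ (expR_ge1Dx _)).
apply: (@le_trans _ _ (((1 - t)^-1 + (1 + t)^-1) / 2)); first by lra.
have -> : ((1 - t)^-1 + (1 + t)^-1) / 2 = (1 - t ^+ 2)^-1.
  by field; apply/and3P; split; apply/negP => /eqP ?; nra.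
rewrite -[leLHS]mul1r ler_pdivrMr; last lra.
have : 0 <= t ^+ 2 by exact: sqr_ge0.
set x := t ^+ 2 in t2 *; nra.
Qed.

(** Markov's inequality bounds the factors by E u^(-f) and u^(-r) E u^f, so [bexp_moments] applies.
    With u = exp t the exponent is 2 K t^2 - r t, which is smallest at t = r / (4 K). *)
Lemma bexp_isoperimetry (R : realType) (T : finType) (p : R)
    (ls : seq (seq T)) (f : {set T} -> nat) (r : nat) :
  0 <= p <= 1 -> (0 < size ls)%N -> (r <= size ls)%N ->
  (forall l (S S1 S2 : {set T}), l \in ls -> S1 \subset l -> S2 \subset l ->
     (f (S :|: S1) <= (f (S :|: S2)).+1)%N) ->
  bexp p (flatten ls) (fun S => (f S == 0)%N%:R) *
  bexp p (flatten ls) (fun S => (r <= f S)%N%:R) <=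
  expR (- r%:R ^+ 2 / (8 * (size ls)%:R)).
Proof.
move=> p01 ls0 rls fL.
set K := (size ls)%:R : R; have K0 : 0 < K by rewrite ltr0n.
set t := r%:R / (4 * K); set u := expR t.
have t0 : 0 <= t by rewrite divr_ge0// mulr_ge0// ltW.
have u1 : 1 <= u by rewrite -expR0 ler_expR.
have u0 : 0 < u by apply: lt_le_trans u1.
have rK : r%:R <= K by rewrite ler_nat.
have t4 : t <= 4^-1 by rewrite /t ler_pdivrMr ?mulr_gt0//; lra.
have h1 : bexp p (flatten ls) (fun S => (f S == 0)%N%:R) <=
          bexp p (flatten ls) (fun S => u ^- f S).
  apply: ler_bexp => // S _; case: eqP => [->|_]; first by rewrite expr0 invr1.
  by rewrite invr_ge0 exprn_ge0 ?ltW.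
have h2 : bexp p (flatten ls) (fun S => (r <= f S)%N%:R) <=
          u ^- r * bexp p (flatten ls) (fun S => u ^+ f S).
  rewrite -bexpZ; apply: ler_bexp => // S _.
  case: leqP => rf; last by rewrite mulr_ge0// ?invr_ge0 exprn_ge0 ?ltW.
  by rewrite mulrC ler_pdivlMr ?exprn_gt0// mul1r ler_weXn2l.
have pos (g : {set T} -> R) : (forall S, 0 <= g S) -> 0 <= bexp p (flatten ls) g.
  by move=> g0; rewrite -(bexp_const p 0 (flatten ls)); apply: ler_bexp.
apply: (le_trans (ler_pM _ _ h1 h2)); try by apply: pos => S; rewrite ler0n.
rewrite mulrCA [X in _ * X]mulrC.
have hm := bexp_moments p01 u1 fL.
apply: (@le_trans _ _ (u ^- r * ((u + u^-1) / 2) ^+ size ls)).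
  by rewrite ler_pM2l ?invr_gt0 ?exprn_gt0.
apply: (@le_trans _ _ (u ^- r * expR (2 * t ^+ 2) ^+ size ls)).
  rewrite ler_pM2l ?invr_gt0 ?exprn_gt0// lerXn2r ?nnegrE ?expR_ge0//.
    by rewrite divr_ge0// addr_ge0// ?invr_ge0 ltW.
  by apply: cosh_le_expR_sqr; nra.
rewrite /u -expRM_natl -expRN -expRM_natl -expRD ler_expR -/K.
by rewrite le_eqVlt; apply/orP; left; apply/eqP; rewrite /t; field; rewrite gt_eqF.
Qed.

(** Double counting: a pair (S, e) with e outside S is sent injectively to e |: S with e marked, and
    [D] survives the addition of e. *)
Lemma card_increasing_step (T : finType) (A : {set T}) (D : pred {set T}) (m : nat) :
  (forall (S : {set T}) e, S \subset A -> e \in A -> D S -> D (e |: S)) ->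
  ((#|A| - m) * #|[set S : {set T} | [&& S \subset A, #|S| == m & D S]]| <=
   m.+1 * #|[set S : {set T} | [&& S \subset A, #|S| == m.+1 & D S]]|)%N.
Proof.
move=> Dinc.
set L := [set S : {set T} | _]; set U := [set S : {set T} | [&& _, _ == m.+1 & _]].
have -> : ((#|A| - m) * #|L| = \sum_(S in L) \sum_(e in A :\: S) 1)%N.
  rewrite mulnC -sum_nat_const; apply: eq_bigr => S; rewrite inE => /and3P[SA /eqP Sm _].
  by rewrite sum1_card cardsD (setIidPr SA) Sm.
have -> : (m.+1 * #|U| = \sum_(S in U) \sum_(e in A | e \in S) 1)%N.
  rewrite mulnC -sum_nat_const; apply: eq_bigr => S; rewrite inE => /and3P[SA /eqP Sm _].
  rewrite sum1_card -Sm; apply: eq_card => e.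
  by rewrite [RHS]unfold_in; apply/idP/andP => [eS|[]//]; rewrite eS (fintype.subsetP SA).
rewrite (exchange_big_dep (mem A)) /=; last by move=> S e _ /setDP[].
rewrite [leqRHS](exchange_big_dep (mem A)) /=; last by move=> S e _ /andP[].
apply: leq_sum => e eA; rewrite !sum1_card.
rewrite -(card_in_imset (f := fun S => e |: S)).
  apply: subset_leq_card; apply/fintype.subsetP => _ /imsetP[S + ->].
  move=> /andP[]; rewrite inE => /and3P[SA /eqP Sm DS] /setDP[_ eS].
  apply/and3P; split; [|exact: eA|exact: (setU11 e S)].
  suff: e |: S \in U by [].
  by rewrite inE cardsU1 eS Sm eqxx Dinc// subUset sub1set eA SA.
move=> S S' /andP[_ /setDP[_ eS]] /andP[_ /setDP[_ eS']] E.
by rewrite -(setU1K eS) E setU1K.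
Qed.

(** Iterates the previous step with (j+1) C(N, j+1) = (N - j) C(N, j). After division by the
    binomial coefficients it compares the proportions of [D] at two sizes. *)
Lemma card_increasing (T : finType) (A : {set T}) (D : pred {set T}) (m j : nat) :
  (forall (S : {set T}) e, S \subset A -> e \in A -> D S -> D (e |: S)) ->
  (m <= j <= #|A|)%N ->
  (#|[set S : {set T} | [&& S \subset A, #|S| == m & D S]]| * 'C(#|A|, j) <=
   #|[set S : {set T} | [&& S \subset A, #|S| == j & D S]]| * 'C(#|A|, m))%N.
Proof.
move=> Dinc /andP[]; elim: j => [|j IH] mj jA.
  by move: mj; rewrite leqn0 => /eqP ->.
move: mj; rewrite leq_eqVlt => /orP[/eqP -> //|]; rewrite ltnS => mj.
have {}IH := IH mj (ltnW jA).
rewrite -(leq_pmul2l (ltn0Sn j)).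
rewrite mulnCA mul_bin_left mulnCA.
apply: (leq_trans (leq_mul (leqnn (#|A| - j)) IH)).
by rewrite !mulnA leq_mul2r card_increasing_step ?orbT.
Qed.

(* Conditioned on its size [j], the binomial subset is uniform, and for [j >= m]
   an increasing property is at least as likely at size [j] as at size [m]. *)
Lemma increasing_uniform_le_binomial (R : realType) (T : finType) (A : {set T})
    (D : pred {set T}) (m : nat) (p : R) : 0 <= p <= 1 ->
  (forall (S : {set T}) e, S \subset A -> e \in A -> D S -> D (e |: S)) ->
  #|[set S : {set T} | [&& S \subset A, #|S| == m & D S]]|%:R / 'C(#|A|, m)%:R *
  bexp p (enum A) (fun S => (m <= #|S|)%N%:R) <=
  bexp p (enum A) (fun S => (D S)%:R).
Proof.
move=> /andP[p0 p1] Dinc.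
set w := fun j => p ^+ j * (1 - p) ^+ (#|A| - j).
have w0 j : 0 <= w j by rewrite mulr_ge0// exprn_ge0// subr_ge0.
set N := fun (Q : pred {set T}) j =>
   #|[set S : {set T} | [&& S \subset A, #|S| == j & Q S]]|.
have sumE (Q : pred {set T}) : bexp p (enum A) (fun S => (Q S)%:R) =
    \sum_(j < #|A|.+1) w j * (N Q j)%:R.
  rewrite bexpE ?enum_uniq// -cardE.
  rewrite (eq_bigl (fun S : {set T} => S \subset A)); last first.
    move=> S; apply/fintype.subsetP/fintype.subsetP => h x /h; by rewrite mem_enum.
  (* Subsets of [A] have at most [#|A|] elements, so [inord] never takes its default value here. *)
  rewrite (partition_big (fun S : {set T} => inord #|S| : 'I_#|A|.+1) xpredT)//=.
  apply: eq_bigr => j _.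
  rewrite /N; set W := [set S | _].
  rewrite -[#|W|]sum1_card natr_sum mulr_sumr [RHS]big_mkcond [LHS]big_mkcond /=.
  apply: eq_bigr => S _; rewrite inE.
  case: (boolP (S \subset A)) => SA //=.
  have SI : (#|S| < #|A|.+1)%N by rewrite ltnS subset_leq_card.
  rewrite -val_eqE/= inordK//; case: eqP => // ->.
  by case: (Q S); rewrite ?mulr0 ?mulr1.
rewrite !sumE mulr_sumr; apply: ler_sum => j _.
rewrite mulrCA ler_wpM2l//.
case: (leqP m j) => mj; last first.
  rewrite (_ : N _ j = 0)%N ?mulr0 ?ler0n//.
  apply/eqP; rewrite cards_eq0 -subset0; apply/fintype.subsetP => S.
  by rewrite inE => /and3P[_ /eqP ->]; rewrite leqNgt mj.
have jA : (j <= #|A|)%N by rewrite -ltnS.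
have -> : N (fun S => m <= #|S|)%N j = 'C(#|A|, j).
  rewrite -cards_draws; congr #|pred_of_set _|; apply/setP => S; rewrite !inE.
  by case: eqP => [->|]; rewrite ?mj ?andbT ?andbF.
rewrite mulrAC ler_pdivrMr ?ltr0n ?bin_gt0 ?(leq_trans mj)//.
by rewrite -!natrM ler_nat card_increasing// mj jA.
Qed.

(** Chernoff bound with the weight (1+t)^(m - |S|). Tilting by 1/(1+t) instead of exp(-t) keeps the
    resulting exponent rational in [t]. *)
Lemma bexp_card_lt (R : realType) (T : finType) (A : {set T}) (m : nat) (p t : R) :
  0 <= p <= 1 -> 0 <= t ->
  bexp p (enum A) (fun S => (#|S| < m)%N%:R) <=
  expR (t * (m%:R - p * #|A|%:R / (1 + t))).
Proof.
move=> p01 t0; have /andP[p0 p1] := p01.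
have t1 : 0 < 1 + t by lra.
apply: (@le_trans _ _ (bexp p (enum A) (fun S => (1 + t) ^+ m * (1 + t)^-1 ^+ #|S|))).
  apply: ler_bexp => // S _; case: ltnP => mS.
    rewrite exprVn ler_pdivlMr ?exprn_gt0// mul1r.
    by apply: ler_weXn2l; [lra|exact: ltnW].
  by rewrite mulr_ge0// exprn_ge0// ?invr_ge0 ltW.
rewrite bexpZ bexp_exp_card ?enum_uniq// -cardE.
rewrite mulrBr expRD; apply: ler_pM => //; rewrite ?exprn_ge0 ?(ltW t1)//.
- by rewrite addr_ge0 ?subr_ge0// mulr_ge0// invr_ge0 ltW.
- by rewrite mulrC expRM_natl lerXn2r ?nnegrE ?expR_ge0 ?(ltW t1)// expR_ge1Dx.
- have -> : - (t * (p * #|A|%:R / (1 + t))) = #|A|%:R * (- (p * (t / (1 + t)))).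
    by field; rewrite gt_eqF.
  rewrite expRM_natl lerXn2r ?nnegrE ?expR_ge0//.
    by rewrite addr_ge0 ?subr_ge0// mulr_ge0// invr_ge0 ltW.
  apply: le_trans (expR_ge1Dx _).
  rewrite le_eqVlt; apply/orP; left; apply/eqP.
  by field; rewrite gt_eqF.
Qed.

(** Allows elements to be exposed colour by colour instead of in the order of [enum]. *)
Lemma bexp_eq_mem (R : realType) (T : finType) (p : R) (s t : seq T)
    (f : {set T} -> R) : uniq s -> uniq t -> s =i t -> bexp p s f = bexp p t f.
Proof.
move=> us ut st; rewrite !bexpE//.
have -> : size s = size t.
  by apply: perm_size; apply: uniq_perm.
by apply: eq_bigl => S; apply: eq_subset_r.
Qed.

(** Hamming distance, a set being read as the [K]-tuple of its colour classes. *)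
Definition color_dist (T : finType) (K : nat) (c : T -> 'I_K) (S S' : {set T}) : nat :=
  #|[set i | [set e in S | c e == i] != [set e in S' | c e == i]]|.

Lemma color_dist_lip (T : finType) (K : nat) (c : T -> 'I_K) (i : 'I_K)
    (S S1 S2 X : {set T}) :
  (forall e, e \in S1 -> c e = i) -> (forall e, e \in S2 -> c e = i) ->
  (color_dist c (S :|: S1) X <= (color_dist c (S :|: S2) X).+1)%N.
Proof.
move=> h1 h2; rewrite -add1n -(cards1 i) /color_dist.
apply: leq_trans (leq_card_setU _ _); apply: subset_leq_card.
apply/fintype.subsetP => j; rewrite !inE; have [//|ji] := eqVneq j i.
suff h (S' : {set T}) : (forall e, e \in S' -> c e = i) ->
    [set e in S :|: S' | c e == j] = [set e in S | c e == j] by rewrite (h _ h1) (h _ h2).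
move=> h; apply/setP => e; rewrite !inE; case: (boolP (e \in S')) => [/h ->|].
  by rewrite eq_sym (negbTE ji) !andbF.
by rewrite orbF.
Qed.

(** Isoperimetry for the distance to [F]: it vanishes on [F], and as a minimum of 1-Lipschitz
    functions it is 1-Lipschitz in each colour class. *)
Lemma bexp_color_dist (R : realType) (T : finType) (A : {set T}) (p : R) (K r : nat)
    (c : T -> 'I_K) (F : pred {set T}) : 0 <= p <= 1 -> (r <= K)%N -> (0 < K)%N ->
  bexp p (enum A) (fun S => (F S)%:R) *
  bexp p (enum A) (fun S => [forall S' : {set T}, F S' ==> (r <= color_dist c S S')%N]%:R)
  <= expR (- r%:R ^+ 2 / (8 * K%:R)).
Proof.
move=> p01 rK K0.
(* The minimum over [F] needs a witness [S0]; if there is none, the first factor is 0. *)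
have [/existsP[S0 FS0]|/existsPn noF] := boolP [exists S : {set T}, F S]; last first.
  rewrite (bexp_ext _ _ (g := fun=> 0)); last by move=> S; rewrite (negbTE (noF S)).
  by rewrite bexp_const mul0r expR_ge0.
pose f S := color_dist c S [arg min_(S' < S0 | F S') color_dist c S S']%N.
pose ls := [seq [seq e <- enum A | c e == i] | i <- enum 'I_K].
have sls : size ls = K by rewrite size_map size_enum_ord.
have mls : flatten ls =i enum A.
  move=> e; apply/flattenP/idP => [[l /mapP[i _ ->]]|eA].
    by rewrite mem_filter => /andP[].
  exists [seq e' <- enum A | c e' == c e]; last by rewrite mem_filter eqxx.
  by apply/mapP; exists (c e); rewrite ?mem_enum.
have uls : uniq (flatten ls).
  rewrite /ls; have : uniq (enum 'I_K) by exact: enum_uniq.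
  elim: (enum 'I_K) => //= i s IH /andP[iNs us].
  rewrite cat_uniq filter_uniq ?enum_uniq//= IH// andbT.
  apply/hasPn => e /flattenP[l /mapP[j js ->]]; rewrite !mem_filter => /andP[/eqP -> _].
  by apply/negP => /andP[/eqP ji _]; rewrite -ji js in iNs.
rewrite !(bexp_eq_mem p _ (enum_uniq _) uls (fun x => esym (mls x))).
have fL l (S S1 S2 : {set T}) : l \in ls -> S1 \subset l -> S2 \subset l ->
    (f (S :|: S1) <= (f (S :|: S2)).+1)%N.
  move=> /mapP[i _ ->] s1 s2; rewrite {2}/f; case: arg_minnP => // X FX _.
  apply: (@leq_trans (color_dist c (S :|: S1) X)).
    by rewrite /f; case: arg_minnP => // Y _; apply.
  apply: (@color_dist_lip _ _ _ i) => e.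
    by move=> /(fintype.subsetP s1); rewrite mem_filter => /andP[/eqP].
  by move=> /(fintype.subsetP s2); rewrite mem_filter => /andP[/eqP].
have := @bexp_isoperimetry _ _ p ls f r p01; rewrite sls => /(_ K0 rK fL); apply: le_trans.
have pos (g : {set T} -> bool) : 0 <= bexp p (flatten ls) (fun S => (g S)%:R).
  by rewrite -(bexp_const p 0 (flatten ls)); apply: ler_bexp.
apply: ler_pM => //; apply: ler_bexp => // S _; rewrite ler_nat.
  case: (boolP (F S)) => //= FS; rewrite /f; case: arg_minnP => // X _ /(_ S FS).
  by rewrite {2}/color_dist; under eq_finset do rewrite eqxx/=; rewrite cards0 leqn0 => ->.
case: forallP => //= h; rewrite /f; case: arg_minnP => // X FX _.
by have /implyP/(_ FX) -> := h X.
Qed.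

(* Weighted AM-GM: [Y <= mu / 2 + mu / (4 V) Y^2 + (V / mu) 1_{Y >= mu / 2}],
   whose expectation is the claim. *)
Lemma paley_zygmund_half (R : realType) (T : finType) (p : R) (es : seq T)
    (Y : {set T} -> R) (mu V : R) : 0 <= p <= 1 -> 0 < mu -> 0 < V ->
  (forall S, 0 <= Y S) ->
  bexp p es Y = mu -> bexp p es (fun S => Y S ^+ 2) <= V ->
  mu ^+ 2 / (4 * V) <= bexp p es (fun S => (mu / 2 <= Y S)%R%:R).
Proof.
move=> p01 mu0 V0 Y0 EY EV; set P := bexp p es _.
have h : mu <= mu / 2 + (mu / (4 * V) * V + V / mu * P).
  rewrite -{1}EY -(bexp_const p (mu / 2) es).
  apply: (@le_trans _ _ (bexp p es (fun=> mu / 2) +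
     (mu / (4 * V) * bexp p es (fun S => Y S ^+ 2) + V / mu * P))); last first.
    by rewrite lerD2l lerD2r ler_wpM2l// divr_ge0 ?mulr_ge0 ?ltW.
  rewrite -!bexpZ -!bexpD; apply: ler_bexp => // S _.
  have c1 : 0 <= mu / (4 * V) * Y S ^+ 2.
    by rewrite mulr_ge0 ?sqr_ge0// divr_ge0 ?mulr_ge0 ?ltW.
  case: (leP (mu / 2) (Y S)) => YS /=; last by rewrite mulr0 addr0; lra.
  rewrite mulr1; set y := Y S in c1 YS *.
  have : 0 <= (mu / (2 * V) * y - 1) ^+ 2 * (V / mu).
    by rewrite mulr_ge0 ?sqr_ge0// divr_ge0 ?ltW.
  have -> : (mu / (2 * V) * y - 1) ^+ 2 * (V / mu) =
     mu / (4 * V) * y ^+ 2 + V / mu - y.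
    by field; rewrite !gt_eqF.
  have := mu0; lra.
have e1 : mu / (4 * V) * V = mu / 4 by field; rewrite gt_eqF.
rewrite e1 in h; have : mu / 4 <= V / mu * P by lra.
rewrite -(ler_pM2l (x := mu / V)); last by rewrite divr_gt0.
have -> : mu / V * (V / mu * P) = P by field; rewrite !gt_eqF.
by apply: le_trans; rewrite le_eqVlt; apply/orP; left; apply/eqP; field; rewrite gt_eqF.
Qed.

(** * Independent transversals *)

Definition pairs (T : finType) (S : {set T}) : {set {set T}} :=
  [set e : {set T} | (e \subset S) && (#|e| == 2%N)].

Lemma card_pairs (T : finType) (S : {set T}) : #|pairs S| = 'C(#|S|, 2).
Proof. exact: cards_draws. Qed.

Lemma pairsI (T : finType) (S S' : {set T}) :
  pairs (S :&: S') = pairs S :&: pairs S'.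
Proof.
apply/setP => e; rewrite !inE subsetI.
by case: (e \subset S); case: (e \subset S'); case: (#|e| == 2%N).
Qed.

Lemma card_pairsU (T : finType) (S S' : {set T}) :
  (#|pairs S :|: pairs S'| + 'C(#|S :&: S'|, 2) = 'C(#|S|, 2) + 'C(#|S'|, 2))%N.
Proof. by rewrite -!card_pairs pairsI cardsUI. Qed.

Lemma pairsS (T : finType) (S S' : {set T}) :
  S \subset S' -> pairs S \subset pairs S'.
Proof.
move=> sS; apply/fintype.subsetP => e; rewrite !inE => /andP[eS ->].
by rewrite (fintype.subset_trans eS).
Qed.

Lemma is_graphE (n : nat) (E : {set {set 'I_n}}) :
  is_graph E = (E \subset pairs [set: 'I_n]).
Proof.
apply/forall_inP/fintype.subsetP => h e /h; rewrite inE; last by case/andP.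
by rewrite subsetT.
Qed.

Lemma independentE (n : nat) (E : {set {set 'I_n}}) (S : {set 'I_n}) :
  is_graph E -> independent E S = [disjoint E & pairs S].
Proof.
move=> /forall_inP gE; rewrite disjoint_subset; apply/forall_inP/fintype.subsetP => h e eE.
  by rewrite !inE (negbTE (h _ eE)).
by have := h _ eE; rewrite !inE gE// andbT.
Qed.

Lemma independentS (n : nat) (E E' : {set {set 'I_n}}) (S : {set 'I_n}) :
  E \subset E' -> independent E' S -> independent E S.
Proof.
by move=> /fintype.subsetP EE' /forall_inP h; apply/forall_inP => e /EE' /h.
Qed.

Lemma slot_subproof (n K b : nat) (h : (K * b <= n)%N) (i : 'I_K) (a : 'I_b) :
  (i + a * K < n)%N.
Proof.
apply: leq_trans h; apply: (@leq_trans (a.+1 * K)); first by rewrite mulSn ltn_add2r.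
by rewrite mulnC leq_mul2l ltn_ord orbT.
Qed.

(* Classes are residues mod [K], so that the [n - K * b] leftover vertices,
   which no transversal uses, have a class as well. *)
Definition slot (n K b : nat) (h : (K * b <= n)%N) (i : 'I_K) (a : 'I_b) : 'I_n :=
  Ordinal (slot_subproof h i a).

Lemma slot_mod (n K b : nat) (h : (K * b <= n)%N) (i : 'I_K) (a : 'I_b) :
  (slot h i a %% K)%N = i.
Proof. by rewrite /= addnC modnMDl modn_small. Qed.

Lemma slot_inj (n K b : nat) (h : (K * b <= n)%N) (i j : 'I_K) (a a' : 'I_b) :
  slot h i a = slot h j a' -> i = j /\ a = a'.
Proof.
move=> E; have ij : i = j by apply: val_inj; rewrite /= -(slot_mod h i a) E slot_mod.
split=> //; move: (congr1 val E); rewrite /= ij => /addnI /eqP.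
rewrite eqn_mul2r; case: (K) i {E ij} j => [[]//|K'] _ _ /= /eqP; exact: val_inj.
Qed.

Definition transversal_set (n K b : nat) (h : (K * b <= n)%N)
    (f : {ffun 'I_K -> 'I_b}) (J : {set 'I_K}) : {set 'I_n} :=
  [set slot h i (f i) | i in J].

Lemma card_transversal_set (n K b : nat) (h : (K * b <= n)%N)
    (f : {ffun 'I_K -> 'I_b}) (J : {set 'I_K}) : #|transversal_set h f J| = #|J|.
Proof. by rewrite card_imset// => i j /slot_inj[]. Qed.

Lemma mem_transversal_set (n K b : nat) (h : (K * b <= n)%N)
    (f : {ffun 'I_K -> 'I_b}) (J : {set 'I_K}) i a :
  (slot h i a \in transversal_set h f J) = (i \in J) && (f i == a).
Proof.
apply/imsetP/andP => [[j jJ /slot_inj[-> ->]]|[iJ /eqP <-]] //.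
by exists i.
Qed.

Lemma card_transversal_setI (n K b : nat) (h : (K * b <= n)%N)
    (f g : {ffun 'I_K -> 'I_b}) :
  #|transversal_set h f [set: 'I_K] :&: transversal_set h g [set: 'I_K]| =
  #|[set i | f i == g i]|.
Proof.
rewrite -(card_transversal_set h f); congr #|pred_of_set _|.
apply/setP => v; rewrite inE; apply/andP/imsetP => [[/imsetP[i _ ->]]|[i]].
  by rewrite mem_transversal_set inE => /eqP gf; exists i; rewrite // inE gf.
rewrite inE => /eqP fg ->; rewrite !mem_transversal_set !inE fg eqxx.
by split.
Qed.

(* An edge between two classes is revealed with the larger one; an edge then
   keeps its status if both ends lie in unaltered classes. *)
Definition edge_color (n K : nat) (e : {set 'I_n}) : 'I_K.+1 :=
  inord (\max_(v in e) (v %% K.+1)).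

Lemma edge_colorP (n K : nat) (e : {set 'I_n}) : (0 < #|e|)%N ->
  exists2 v, v \in e & edge_color K e = (v %% K.+1)%N :> nat.
Proof.
move=> /(eq_bigmax_cond (fun v : 'I_n => v %% K.+1)%N)[v ve E]; exists v => //.
by rewrite /edge_color E inordK// ltn_pmod.
Qed.

(** An edge of [E] inside the partial transversal has its colour among the classes of its ends,
    hence in [J]. It is therefore also an edge of [E'], inside a set independent there. *)
Lemma transversal_transfer (n K b : nat) (h : (K.+1 * b <= n)%N)
    (f : {ffun 'I_K.+1 -> 'I_b}) (J : {set 'I_K.+1}) (E E' : {set {set 'I_n}}) :
  is_graph E ->
  (forall i, i \in J -> [set e in E | edge_color K e == i] =
                        [set e in E' | edge_color K e == i]) ->
  independent E' (transversal_set h f [set: 'I_K.+1]) ->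
  independent E (transversal_set h f J).
Proof.
move=> /forall_inP gE EE' /forall_inP iE'; apply/forall_inP => e eE; apply/negP => eJ.
have e0 : (0 < #|e|)%N by rewrite (eqP (gE _ eE)).
have [v ve cv] := edge_colorP K e0.
have /imsetP[i iJ vi] := fintype.subsetP eJ _ ve.
have ci : edge_color K e = i by apply: val_inj; rewrite /= cv vi slot_mod.
have eE' : e \in E'.
  have : e \in [set e in E | edge_color K e == i] by rewrite inE eE ci eqxx.
  by rewrite EE'// inE => /andP[].
have /negP := iE' _ eE'; apply; apply: fintype.subset_trans eJ _.
by apply: imsetS; exact: subsetT.
Qed.

(** Restriction to [J] turns transversals independent in [E'] into independent sets of [E]. Two with
    the same restriction differ only outside [J], so each fibre has at most [b ^ #|~: J|]
    elements. *)
Lemma card_transversal_le (n K b : nat) (h : (K.+1 * b <= n)%N)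
    (J : {set 'I_K.+1}) (E E' : {set {set 'I_n}}) :
  is_graph E ->
  (forall i, i \in J -> [set e in E | edge_color K e == i] =
                        [set e in E' | edge_color K e == i]) ->
  (#|[set f : {ffun 'I_K.+1 -> 'I_b} |
        independent E' (transversal_set h f [set: 'I_K.+1])]| <=
   #|indep_k E #|J| | * b ^ #|~: J|)%N.
Proof.
move=> gE EE'; set F := [set f | _].
rewrite -sum1_card (partition_big (fun f => transversal_set h f J)
  (fun S => S \in indep_k E #|J|)) /=; last first.
  move=> f; rewrite !inE card_transversal_set eqxx andbT.
  exact: transversal_transfer.
rewrite -sum_nat_const; apply: leq_sum => S _.
rewrite sum1_card; set Q := (X in #|X|).
have [/existsP[f0 Qf0]|/existsPn noQ] := boolP [exists f, f \in Q]; last first.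
  by rewrite eq_card0// => f; apply/negbTE/noQ.
have f0S : transversal_set h f0 J = S by move: Qf0 => /andP[_ /eqP].
apply: (@leq_trans #|family (fun i => if i \in J then pred1 (f0 i) else predT)|).
  apply: subset_leq_card; apply/fintype.subsetP => f /andP[_ /eqP fS].
  apply/familyP => i; case: ifP => // iJ.
  have : slot h i (f i) \in transversal_set h f0 J.
    by rewrite f0S -fS mem_transversal_set iJ eqxx.
  by rewrite mem_transversal_set iJ => /eqP <-; rewrite inE.
rewrite card_family foldrE big_image /=.
rewrite (bigID (fun i => i \in J)) /= big1 ?mul1n; last first.
  by move=> i ->; rewrite card1.
rewrite (eq_bigr (fun=> b)); last by move=> i /negbTE ->; rewrite card_ord.
rewrite prod_nat_const leq_eqVlt; apply/orP; left; apply/eqP; congr (_ ^ _)%N.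
by apply: eq_card => i; rewrite inE.
Qed.

(** The sum factors over the coordinates: each contributes [rho] for the agreeing value and 1 for
    every other value. *)
Lemma sum_ffun_agree (R : realType) (K b : nat) (rho : R) (f : {ffun 'I_K -> 'I_b}) :
  0 <= rho ->
  \sum_(g : {ffun 'I_K -> 'I_b}) rho ^+ #|[set i | f i == g i]| <= (b%:R + rho) ^+ K.
Proof.
move=> rho0.
rewrite (eq_bigr (fun g : {ffun 'I_K -> 'I_b} =>
    \prod_(i < K) (if f i == g i then rho else 1))); last first.
  move=> g _; rewrite -big_mkcond /= -prodr_const.
  by apply: eq_bigl => i; rewrite inE.
rewrite -(bigA_distr_bigA (fun i a => if f i == a then rho else 1)) /=.
apply: (@le_trans _ _ (\prod_(i < K) (b%:R + rho))); last first.
  by rewrite prodr_const card_ord.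
apply: ler_prod => i _; apply/andP; split.
  by apply: sumr_ge0 => a _; case: ifP.
apply: (@le_trans _ _ (\sum_(a < b) (1 + (if f i == a then rho else 0)))).
  by apply: ler_sum => a _; case: ifP => _; lra.
rewrite big_split /= sumr_const card_ord -big_mkcond /= (big_pred1 (f i)) //.
Qed.

Definition transversal_count (R : realType) (n K b : nat) (hn : (K * b <= n)%N)
    (E : {set {set 'I_n}}) : R :=
  \sum_(f : {ffun 'I_K -> 'I_b})
    (independent E (transversal_set hn f [set: 'I_K]))%:R.

Lemma transversal_first_moment (R : realType) (n K b : nat) (p : R)
    (hn : (K * b <= n)%N) :
  bexp p (enum (pairs [set: 'I_n])) (transversal_count R hn) =
  b%:R ^+ K * (1 - p) ^+ 'C(K, 2).
Proof.
rewrite /transversal_count bexp_sum (eq_bigr (fun=> (1 - p) ^+ 'C(K, 2))).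
  by rewrite sumr_const card_ffun !card_ord -[LHS]mulr_natl natrX.
move=> f _; set S := transversal_set _ _ _.
have -> : 'C(K, 2) = #|pairs S| by rewrite card_pairs card_transversal_set cardsT card_ord.
rewrite -(bexp_avoid p (enum_uniq (pairs [set: 'I_n]))); last first.
  by move=> e; rewrite mem_enum; apply/fintype.subsetP/pairsS/subsetT.
apply: bexp_ext_sub => E sE; rewrite independentE//.
by rewrite is_graphE; apply/fintype.subsetP => e /sE; rewrite mem_enum.
Qed.

(** Two transversals agreeing in [s] classes share C(s, 2) vertex pairs. The hypothesis on [rho]
    replaces the gain (1-p)^(-C(s,2)) by rho^s, which is multiplicative over the classes. *)
Lemma transversal_second_moment (R : realType) (n K b : nat) (p rho : R)
    (hn : (K * b <= n)%N) : 0 <= p <= 1 -> 0 <= rho ->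
  (forall s, (s <= K)%N -> 1 <= rho ^+ s * (1 - p) ^+ 'C(s, 2)) ->
  bexp p (enum (pairs [set: 'I_n])) (fun E => transversal_count R hn E ^+ 2) <=
  b%:R ^+ K * (b%:R + rho) ^+ K * (1 - p) ^+ ('C(K, 2) + 'C(K, 2)).
Proof.
move=> /andP[p0 p1] rho0 Hrho.
have q0 : 0 <= 1 - p by rewrite subr_ge0.
rewrite (bexp_ext _ _ (g := fun E => \sum_f \sum_g
   ((independent E (transversal_set hn f [set: 'I_K]))%:R *
    (independent E (transversal_set hn g [set: 'I_K]))%:R))); last first.
  move=> E; rewrite expr2 /transversal_count mulr_suml; apply: eq_bigr => f _.
  by rewrite mulr_sumr.
rewrite bexp_sum -mulrA.
apply: (@le_trans _ _ (\sum_(f : {ffun 'I_K -> 'I_b})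
    ((b%:R + rho) ^+ K * (1 - p) ^+ ('C(K, 2) + 'C(K, 2))))); last first.
  by rewrite sumr_const card_ffun !card_ord -[leLHS]mulr_natl natrX.
apply: ler_sum => f _; rewrite bexp_sum.
apply: (@le_trans _ _ (\sum_(g : {ffun 'I_K -> 'I_b})
    rho ^+ #|[set i | f i == g i]| * (1 - p) ^+ ('C(K, 2) + 'C(K, 2)))); last first.
  by rewrite -mulr_suml ler_wpM2r ?exprn_ge0// sum_ffun_agree.
apply: ler_sum => g _.
set S := transversal_set _ f _; set S' := transversal_set _ g _.
have cS (h : {ffun 'I_K -> 'I_b}) : #|transversal_set hn h [set: 'I_K]| = K.
  by rewrite card_transversal_set cardsT card_ord.
have cU := card_pairsU S S'; rewrite card_transversal_setI !cS in cU.
have -> : bexp p (enum (pairs [set: 'I_n]))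
      (fun E => (independent E S)%:R * (independent E S')%:R) =
    (1 - p) ^+ #|pairs S :|: pairs S'|.
  rewrite -(bexp_avoid p (enum_uniq (pairs [set: 'I_n]))); last first.
    move=> e; rewrite mem_enum; apply/fintype.subsetP.
    by rewrite subUset !pairsS ?subsetT.
  apply: bexp_ext_sub => E sE; have gE : is_graph E.
    by rewrite is_graphE; apply/fintype.subsetP => e /sE; rewrite mem_enum.
  rewrite !independentE// -natrM mulnb; congr (_%:R); congr (nat_of_bool _).
  by rewrite -!setI_eq0 setIUr setU_eq0.
rewrite -cU exprD mulrCA ler_peMr ?exprn_ge0//.
by apply: Hrho; rewrite -[leqRHS]card_ord -cardsT subset_leq_card// subsetT.
Qed.

(** The factor before the exponential is the inverse of the second-moment lower bound for the
    probability of [F]; dividing the isoperimetric bound by that probability gives the claim. *)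
Lemma many_indep_binomial (R : realType) (n K r b : nat) (p rho : R) :
  (K.+1 * b <= n)%N -> (0 < b)%N -> (r <= K.+1)%N -> 0 <= p < 1 -> 0 <= rho ->
  (forall s, (s <= K.+1)%N -> 1 <= rho ^+ s * (1 - p) ^+ 'C(s, 2)) ->
  bexp p (enum (pairs [set: 'I_n]))
    (fun E => (#|indep_k E (K.+1 - r)|%:R <
               b%:R ^+ (K.+1 - r) * (1 - p) ^+ 'C(K.+1, 2) / 2)%R%:R)
  <= 4 * (1 + rho / b%:R) ^+ K.+1 * expR (- r%:R ^+ 2 / (8 * K.+1%:R)).
Proof.
move=> hn b0 rK /andP[p0 p1] rho0 Hrho.
have p01 : 0 <= p <= 1 by rewrite p0 ltW.
have q0 : 0 < 1 - p by rewrite subr_gt0.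
have bR : 0 < b%:R :> R by rewrite ltr0n.
pose Y := transversal_count R hn.
set mu := b%:R ^+ K.+1 * (1 - p) ^+ 'C(K.+1, 2).
have mu0 : 0 < mu by rewrite mulr_gt0 ?exprn_gt0.
set V := b%:R ^+ K.+1 * (b%:R + rho) ^+ K.+1 * (1 - p) ^+ ('C(K.+1, 2) + 'C(K.+1, 2)).
have brho : 0 < b%:R + rho by rewrite ltr_wpDr.
have V0 : 0 < V by rewrite !mulr_gt0 ?exprn_gt0.
have Y0 E : 0 <= Y E by apply: sumr_ge0 => f _; rewrite ler0n.
have := paley_zygmund_half p01 mu0 V0 Y0 (transversal_first_moment p hn)
  (transversal_second_moment hn p01 rho0 Hrho).
set PA := bexp _ _ _ => hPA.
have eV : mu ^+ 2 / (4 * V) = (4 * (1 + rho / b%:R) ^+ K.+1)^-1.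
  rewrite /V /mu exprD.
  have -> : 1 + rho / b%:R = (b%:R + rho) / b%:R by field; rewrite gt_eqF.
  rewrite expr_div_n; set x := b%:R ^+ K.+1; set y := (b%:R + rho) ^+ _.
  set z := (1 - p) ^+ _.
  by field; rewrite !gt_eqF ?exprn_gt0.
rewrite eV in hPA.
set c : R := 4 * (1 + rho / b%:R) ^+ K.+1 in hPA *.
have c0 : 0 < c by rewrite mulr_gt0// exprn_gt0// ltr_wpDr// divr_ge0// ltW.
pose F := fun S : {set {set 'I_n}} => mu / 2 <= Y S.
have := @bexp_color_dist R _ (pairs [set: 'I_n]) p K.+1 r (@edge_color n K) F p01 rK isT.
set PB := (X in _ * X) => hiso.
have PB0 : 0 <= PB.
  by rewrite -(bexp_const p 0 (enum (pairs [set: 'I_n]))); apply: ler_bexp.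
apply: (@le_trans _ _ PB); last first.
  rewrite mulrC -ler_pdivrMr//; apply: le_trans hiso.
  by rewrite mulrC ler_wpM2r.
(* A graph with too few independent sets is at distance at least [r] from [F]: otherwise some [E']
   in [F] would pass on at least [mu / 2] transversals, each set being counted at most b^r times. *)
apply: ler_bexp => // E sE; case: ltP => //= Xlt.
have gE : is_graph E.
  by rewrite is_graphE; apply/fintype.subsetP => e /sE; rewrite mem_enum.
rewrite ler1n lt0b; apply/forallP => E'; apply/implyP => FE'.
rewrite leqNgt; apply/negP => dlt.
set C := [set i | [set e in E | edge_color K e == i] != [set e in E' | edge_color K e == i]].
have hC : (K.+1 - r <= #|~: C|)%N.
  rewrite cardsCs setCK card_ord leq_sub2l//; exact: ltnW.
(* More classes than needed may be unaltered; choosing exactly [K.+1 - r] of them fixes the size of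
   the independent sets. *)
have [J /andP[JC /eqP cJ]] : exists J : {set 'I_K.+1},
    (J \subset ~: C) && (#|J| == K.+1 - r)%N.
  have : (0 < #|[set J : {set 'I_K.+1} | (J \subset ~: C) && (#|J| == (K.+1 - r)%N)]|)%N.
    by rewrite cards_draws bin_gt0.
  by rewrite card_gt0 => /set0Pn[J]; rewrite inE => hJ; exists J.
have := @card_transversal_le n K b hn J E E' gE; rewrite cJ => H.
have YE : Y E' <= #|indep_k E (K.+1 - r)|%:R * b%:R ^+ r.
  have -> : Y E' = #|[set f : {ffun 'I_K.+1 -> 'I_b} |
        independent E' (transversal_set hn f [set: 'I_K.+1])]|%:R.
    rewrite /Y /transversal_count -natr_sum; congr (_%:R).
    rewrite -sum1dep_card [RHS]big_mkcond /=.
    by apply: eq_bigr => f _; case: independent.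
  rewrite -natrX -natrM ler_nat.
  have cJ' : #|~: J| = r by rewrite cardsCs setCK card_ord cJ subKn.
  rewrite cJ' in H.
  apply: H => i /(fintype.subsetP JC).
  by rewrite !inE negbK => /eqP.
have : mu / 2 <= #|indep_k E (K.+1 - r)|%:R * b%:R ^+ r by apply: le_trans YE.
rewrite leNgt => /negP; apply.
have -> : mu / 2 = b%:R ^+ (K.+1 - r) * (1 - p) ^+ 'C(K.+1, 2) / 2 * b%:R ^+ r.
  by rewrite /mu -{1}(subnK rK) exprD; ring.
by rewrite ltr_pM2r// exprn_gt0.
Qed.

(** * The uniform model *)

Lemma card_graphs_nm_avoid (n m : nat) (F : {set {set 'I_n}}) :
  F \subset pairs [set: 'I_n] ->
  #|[set E in graphs_nm n m | [disjoint E & F]]| = 'C('C(n, 2) - #|F|, m).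
Proof.
move=> sF; have -> : ('C(n, 2) - #|F| = #|pairs [set: 'I_n] :\: F|)%N.
  by rewrite cardsD (setIidPr sF) card_pairs cardsT card_ord.
rewrite -cards_draws; apply: eq_card => E; rewrite !inE is_graphE subsetD.
by case: (E \subset _); case: (#|E| == m); case: [disjoint E & F].
Qed.

Lemma card_graphs_nm (n m : nat) : #|graphs_nm n m| = 'C('C(n, 2), m).
Proof.
have := @card_graphs_nm_avoid n m set0 (sub0set _); rewrite cards0 subn0 => <-.
by apply: eq_card => E; rewrite !inE -setI_eq0 setI0 eqxx andbT.
Qed.

(** Having few independent sets of size [k] is preserved when edges are added. *)
Lemma many_indep_uniform (R : realType) (n m k : nat) (p a : R) : 0 <= p <= 1 ->
  #|[set E in graphs_nm n m | #|indep_k E k|%:R < a]|%:R / #|graphs_nm n m|%:R *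
  bexp p (enum (pairs [set: 'I_n])) (fun S => (m <= #|S|)%N%:R) <=
  bexp p (enum (pairs [set: 'I_n])) (fun E => (#|indep_k E k|%:R < a)%R%:R).
Proof.
move=> p01.
have := @increasing_uniform_le_binomial R _ (pairs [set: 'I_n])
  (fun E => #|indep_k E k|%:R < a) m p p01.
rewrite card_pairs cardsT card_ord -card_graphs_nm => H.
have -> : [set E in graphs_nm n m | #|indep_k E k|%:R < a] =
  [set S : {set {set 'I_n}} | [&& S \subset pairs [set: 'I_n], #|S| == m &
     #|indep_k S k|%:R < a]].
  by apply/setP => E; rewrite !inE is_graphE andbA.
apply: H => S e _ _; apply: le_lt_trans; rewrite ler_nat.
apply: subset_leq_card; apply/fintype.subsetP => T; rewrite !inE => /andP[iT ->].
by rewrite (independentS _ iT)// subsetUr.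
Qed.

Lemma bin2R (R : realType) (j : nat) : 'C(j, 2)%:R = j%:R * (j%:R - 1) / 2 :> R.
Proof.
case: j => [|j]; first by rewrite mul0r mul0r.
have -> : j.+1%:R - 1 = j%:R :> R by rewrite -natr1 addrK.
have E : (j.+1 * j = 2 * 'C(j.+1, 2))%N by rewrite -mul_bin_diag bin1.
by rewrite -natrM E natrM mulrC mulKf.
Qed.

(** In the ratio of the two binomial coefficients every factor (N-f-i)/(N-i) is at most 1 - f/N,
    hence at most exp(-f/N). *)
Lemma bin_sub_le (R : realType) (N f m : nat) : (f <= N)%N -> (0 < N)%N ->
  'C(N - f, m)%:R <= 'C(N, m)%:R * expR (- (m%:R / N%:R * f%:R)) :> R.
Proof.
move=> fN N0.
have H : ('C(N - f, m) * N ^ m <= 'C(N, m) * (N - f) ^ m)%N.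
  rewrite -(leq_pmul2r (fact_gt0 m)) mulnAC bin_ffact mulnAC bin_ffact.
  elim: m => [|m IH] //; rewrite !ffactnSr !expnSr.
  have h : ((N - f - m) * N <= (N - m) * (N - f))%N.
    have [mN|mN] := leqP (N - f) m.
      by rewrite (_ : N - f - m = 0)%N ?mul0n//; apply/eqP; rewrite subn_eq0.
    nia.
  by have := leq_mul IH h; rewrite !mulnA
    [X in (X <= _)%N](ACl (1*3*2*4)) [X in (_ <= X)%N](ACl (1*3*2*4)).
have NR : 0 < N%:R :> R by rewrite ltr0n.
have -> : - (m%:R / N%:R * f%:R) = m%:R * (- (f%:R / N%:R)) :> R by field; rewrite gt_eqF.
rewrite expRM_natl.
apply: (@le_trans _ _ ('C(N, m)%:R * (1 - f%:R / N%:R) ^+ m)); last first.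
  apply: ler_wpM2l => //; apply: lerXn2r; rewrite ?nnegrE ?expR_ge0 ?expR_ge1Dx//.
  by rewrite subr_ge0 ler_pdivrMr// mul1r ler_nat.
have -> : 1 - f%:R / N%:R = (N - f)%:R / N%:R :> R.
  by rewrite natrB//; field; rewrite gt_eqF.
by rewrite expr_div_n mulrA ler_pdivlMr ?exprn_gt0// -!natrX -!natrM ler_nat.
Qed.

(** One term of the binomial expansion of (1 + exp(-l))^n. For l = ln d the second summand is n/d,
    which will be at most k. *)
Lemma bin_le_expR (R : realType) (n k : nat) (l : R) :
  'C(n, k)%:R <= expR (k%:R * l + n%:R * expR (- l)).
Proof.
have z0 := expR_gt0 (- l).
have [kn|kn] := leqP k n; last by rewrite bin_small// expR_ge0.
have h : 'C(n, k)%:R * expR (- l) ^+ k <= (1 + expR (- l)) ^+ n.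
  rewrite exprDn (bigD1 (inord k)) //= inordK ?ltnS// expr1n mul1r mulr_natl.
  rewrite lerDl; apply: sumr_ge0 => i _.
  by rewrite mulrn_wge0// mulr_ge0 ?expr1n ?exprn_ge0 ?ltW.
rewrite expRD -ler_pdivrMl ?expR_gt0// mulrC -expRN -mulrN !expRM_natl.
apply: le_trans h _; apply: lerXn2r; rewrite ?nnegrE ?expR_ge0 ?expR_ge1Dx//.
Qed.

(** Expanding a product over [T]: a point of [S] is free to be in [t] or not, any other point costs
    [z] when taken. *)
Lemma sum_exp_cardD (R : realType) (T : finType) (S : {set T}) (z : R) :
  \sum_(t : {set T}) z ^+ #|t :\: S| = 2 ^+ #|S| * (1 + z) ^+ #|~: S|.
Proof.
have := @bigA_distr R 0 1 *%R +%R T (fun i : T => if i \in S then 1 else z) (fun=> 1).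
rewrite (bigID (fun i => i \in S)) /=.
rewrite (eq_bigr (fun=> 2)); last by move=> i ->.
rewrite [X in _ * X](eq_bigr (fun=> 1 + z)); last first.
  by move=> i /negbTE ->; rewrite addrC.
rewrite !prodr_const => E; rewrite (_ : #|~: S| = #|[pred i | i \notin S]|); last first.
  by apply: eq_card => i; rewrite !inE.
rewrite E; apply: eq_bigr => J _.
rewrite -prodr_const [LHS]big_mkcond /=; apply: eq_bigr => i _; rewrite inE.
by case: (i \in J); case: (i \in S).
Qed.

(** Put r = |t \ S|. Besides the pairs in [S], the graph must avoid r (|t| + |t & S| - 1) / 2 pairs,
    which costs at least r l (1 + e/2) in the exponent. The part r l pays for the sum over [t], and
    r l e / 2 >= e^2 l k / 2 is the gain. *)
Lemma planted_first_moment (R : realType) (n m k : nat) (l e : R)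
    (cond : rel {set 'I_n}) (mu := m%:R / 'C(n, 2)%:R) :
  (0 < 'C(n, 2))%N -> (m <= 'C(n, 2))%N -> 0 <= l -> 0 <= e ->
  (forall S t : {set 'I_n}, #|S| = k -> cond S t ->
     e * k%:R <= #|t :\: S|%:R /\
     l * (1 + e / 2) <= mu * (#|t|%:R + #|t :&: S|%:R - 1) / 2) ->
  (\sum_(E in graphs_nm n m)
     #|[set S in indep_k E k | [exists t, independent E t && cond S t]]|)%:R /
    #|graphs_nm n m|%:R <=
  'C(n, k)%:R * expR (- (mu * 'C(k, 2)%:R) - e ^+ 2 * l * k%:R / 2) *
  (2 ^+ k * (1 + expR (- l)) ^+ n).
Proof.
rewrite {}/mu; set N := 'C(n, 2); set mu := m%:R / N%:R => N0 mN l0 e0 Hc.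
have mu0 : 0 <= mu by rewrite divr_ge0.
have G0 : 0 < #|graphs_nm n m|%:R :> R by rewrite card_graphs_nm ltr0n bin_gt0.
(* Union bound over [t], then exchange of the sums so that graphs are counted last. *)
have step1 : (\sum_(E in graphs_nm n m)
     #|[set S in indep_k E k | [exists t, independent E t && cond S t]]| <=
   \sum_(S : {set 'I_n} | #|S| == k) \sum_(t | cond S t) 'C(N - #|pairs S :|: pairs t|, m))%N.
  apply: (@leq_trans (\sum_(E in graphs_nm n m) \sum_(S : {set 'I_n} | #|S| == k)
     \sum_(t | cond S t) [disjoint E & pairs S :|: pairs t])%N).
    apply: leq_sum => E; rewrite inE => /andP[gE _].
    rewrite -sum1_card [leqRHS]big_mkcond [leqLHS]big_mkcond /=.
    apply: leq_sum => S _; rewrite !inE.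
    case: (#|S| == k); rewrite ?andbF ?andbT//; case: ifP => //.
    move=> /andP[iS /existsP[t /andP[it ct]]].
    rewrite (bigD1 t)//= (_ : [disjoint _ & _]) ?leq_addr//.
    rewrite -setI_eq0 setIUr setU_eq0 !setI_eq0.
    by rewrite -!independentE// iS it.
  rewrite exchange_big /=; apply: leq_sum => S _.
  rewrite exchange_big /=; apply: leq_sum => t _.
  rewrite -card_graphs_nm_avoid; last by rewrite subUset !pairsS ?subsetT.
  rewrite -sum1_card [leqRHS]big_mkcond [leqLHS]big_mkcond /=.
  apply: leq_sum => E _; rewrite [in leqRHS]inE; case: (E \in _) => //=.
rewrite ler_pdivrMr//.
apply: (@le_trans _ _ (\sum_(S : {set 'I_n} | #|S| == k) \sum_(t | cond S t)
   'C(N - #|pairs S :|: pairs t|, m))%:R); first by rewrite ler_nat.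
rewrite natr_sum.
pose W : R := #|graphs_nm n m|%:R * (expR (- (mu * 'C(k, 2)%:R) - e ^+ 2 * l * k%:R / 2) *
   (2 ^+ k * (1 + expR (- l)) ^+ n)).
apply: (@le_trans _ _ (\sum_(S : {set 'I_n} | #|S| == k) W)); last first.
  have -> : \sum_(S : {set 'I_n} | #|S| == k) W = 'C(n, k)%:R * W.
    rewrite sumr_const -[LHS]mulr_natl; congr (_%:R * _).
    by rewrite -[n in RHS]card_ord -card_draws; apply: eq_card => S; rewrite !inE.
  by rewrite /W le_eqVlt; apply/orP; left; apply/eqP; ring.
apply: ler_sum => S /eqP cS; rewrite natr_sum.
apply: (@le_trans _ _ (\sum_(t : {set 'I_n}) #|graphs_nm n m|%:R *
   expR (- (mu * 'C(k, 2)%:R) - e ^+ 2 * l * k%:R / 2) *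
   expR (- l) ^+ #|t :\: S|)); last first.
  rewrite -mulr_sumr sum_exp_cardD cS /W -!mulrA ler_pM2l// ler_pM2l ?expR_gt0//.
  rewrite ler_pM2l ?exprn_gt0//; apply: ler_weXn2l.
    by rewrite lerDl expR_ge0.
  by rewrite (leq_trans (max_card _))// card_ord.
rewrite big_mkcond /=; apply: ler_sum => t _; case: ifP => [ct|_]; last first.
  by rewrite !mulr_ge0 ?exprn_ge0 ?expR_ge0 ?ltW.
have [ek le] := Hc _ _ cS ct.
have fN : (#|pairs S :|: pairs t| <= N)%N.
  rewrite /N -[n in 'C(n, 2)]card_ord -cardsT -card_pairs subset_leq_card//.
  by rewrite subUset !pairsS ?subsetT.
apply: le_trans (bin_sub_le _ _ fN N0) _.
rewrite card_graphs_nm -/N -[leRHS]mulrA ler_pM2l; last by rewrite ltr0n bin_gt0.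
rewrite -expRM_natl -expRD ler_expR -/mu.
have cU := card_pairsU S t; rewrite cS in cU.
have cUR : #|pairs S :|: pairs t|%:R =
    'C(k, 2)%:R + ('C(#|t|, 2)%:R - 'C(#|S :&: t|, 2)%:R) :> R.
  by rewrite addrA -natrD -cU natrD addrK.
rewrite cUR.
set r := #|t :\: S|%:R in ek *; set s := #|t :&: S|%:R in le *.
have ts : #|t|%:R = s + r :> R by rewrite /s /r -natrD cardsID.
have sE : #|S :&: t|%:R = s :> R by rewrite setIC.
rewrite !bin2R sE ts in le *.
have r0 : 0 <= r by rewrite ler0n.
have h1 : r * (l * (1 + e / 2)) <= r * (mu * (s + r + s - 1) / 2) by rewrite ler_wpM2l.
have h2 : e * k%:R * (l * e / 2) <= r * (l * e / 2).
  by rewrite ler_wpM2r// divr_ge0// mulr_ge0.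
lra.
Qed.

(** A graph with fewer than [a] independent sets is given up entirely. In any other graph the bad
    fraction is at most the number of bad sets divided by [a]; [a > 0] ensures that such a graph has
    an independent set. *)
Lemma probU_lower_bound (R : realType) (n m k : nat) (a : R)
    (P : {set {set 'I_n}} -> {set 'I_n} -> bool) (cond : rel {set 'I_n}) :
  (m <= 'C(n, 2))%N -> 0 < a ->
  (forall E S, S \in indep_k E k -> ~~ P E S -> exists2 t, independent E t & cond S t) ->
  1 - (#|[set E in graphs_nm n m | #|indep_k E k|%:R < a]|%:R / #|graphs_nm n m|%:R +
  (\sum_(E in graphs_nm n m)
     #|[set S in indep_k E k | [exists t, independent E t && cond S t]]|)%:R /
    #|graphs_nm n m|%:R / a) <= probU R m k P.
Proof.
move=> mN a0 HP.
have G0 : 0 < #|graphs_nm n m|%:R :> R by rewrite card_graphs_nm ltr0n bin_gt0.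
rewrite /probU -mulr_sumr [leRHS]mulrC ler_pdivlMr// mulrBl mulrDl mul1r divfK ?gt_eqF//.
set X1 := (_ / a) * _; have -> : X1 = (\sum_(E in graphs_nm n m)
     #|[set S in indep_k E k | [exists t, independent E t && cond S t]]|)%:R / a.
  by rewrite /X1; field; rewrite !gt_eqF.
have -> : #|graphs_nm n m|%:R = \sum_(E in graphs_nm n m) 1 :> R.
  by rewrite sumr_const.
have -> : #|[set E in graphs_nm n m | #|indep_k E k|%:R < a]|%:R =
    \sum_(E in graphs_nm n m) (#|indep_k E k|%:R < a)%R%:R :> R.
  rewrite -natr_sum -sum1_card; congr (_%:R); rewrite [LHS]big_mkcond [RHS]big_mkcond /=.
  by apply: eq_bigr => E _; rewrite inE; case: (E \in _); case: (_ < a).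
rewrite natr_sum mulr_suml -big_split -sumrB /=; apply: ler_sum => E _.
set B := #|[set S in _ | [exists t, _]]|; set X := #|indep_k E k|.
set Gd := #|[set S in _ | P _ _]|.
have BG : (X <= B + Gd)%N.
  apply: leq_trans (leq_card_setU _ _); apply: subset_leq_card.
  apply/fintype.subsetP => S SX; apply/setUP.
  have [PS|nP] := boolP (P E S); [right|left]; rewrite inE SX //=.
  by have [t it ct] := HP _ _ SX nP; apply/existsP; exists t; rewrite it.
have B0 : 0 <= B%:R / a by rewrite divr_ge0 ?ler0n// ltW.
case: (ltP X%:R a) => Xa /=.
  by case: ifP => _; [apply: (@le_trans _ _ 0); [lra|exact: divr_ge0]|lra].
have X0 : 0 < X%:R :> R by apply: lt_le_trans Xa.
rewrite -(ltr0n R) X0 ler_pdivlMr//.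
have : X%:R <= B%:R + Gd%:R :> R by rewrite -natrD ler_nat.
have : B%:R / a * a <= B%:R / a * X%:R by rewrite ler_wpM2l.
rewrite divfK ?gt_eqF//; lra.
Qed.

Lemma probU_le1 (R : realType) (n m k : nat)
    (P : {set {set 'I_n}} -> {set 'I_n} -> bool) : probU R m k P <= 1.
Proof.
rewrite /probU -mulr_sumr; set G := #|_|%:R^-1.
apply: (@le_trans _ _ (G * \sum_(E in graphs_nm n m) 1)).
  rewrite ler_wpM2l ?invr_ge0//; apply: ler_sum => E _.
  case: ifP => // X0; rewrite ler_pdivrMr ?ltr0n// mul1r ler_nat.
  by apply: subset_leq_card; apply/fintype.subsetP => S; rewrite inE => /andP[].
rewrite sumr_const /G.
have [->|n0] := eqVneq (#|graphs_nm n m|%:R : R) 0; first by rewrite mulr0.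
by rewrite mulVf.
Qed.

(** * Numerical estimates *)

(** Three powers suffice below: with [y] proportional to [l], two of them absorb constants and
    powers of [e] through [10 ^+ 7 <= e ^+ 4 * l], and one factor [l] remains. *)
Lemma expR_ge_cube (R : realType) (y : R) : 0 <= y -> (y / 3) ^+ 3 <= expR y.
Proof.
move=> y0; have -> : expR y = expR (y / 3) ^+ 3.
  by rewrite -expRM_natl; congr expR; field.
have h := expR_ge1Dx (y / 3); have : 0 <= y / 3 by lra.
by move=> h0; apply: lerXn2r; rewrite ?nnegrE ?expR_ge0//; lra.
Qed.

(* Relative margin, both in the edge density of the binomial graph and in the
   number of vertex classes beyond [k]. *)
Definition slack (R : realType) (e : R) : R := e ^+ 2 / 200.

(* [l] stands for [ln d] and [kap] for [1 + eps]. *)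
Definition admissible (R : realType) (l e kap : R) : Prop :=
  [/\ 0 < e, e <= 2^-1, 10 ^+ 7 <= e ^+ 4 * l, 1 + e <= kap & kap <= 2 - e].

(** The summands of the threshold on [n] serve separate estimates. The other clauses say that [m]
    and [k] are their ideal values up to a rounding error of 1. *)
Definition large_size (R : realType) (l e kap : R) (n m k : nat) : Prop :=
  let zeta := slack e in let d := expR l in let x := n%:R in
  [/\ 4 * d / zeta + 8 / zeta + 16 / zeta ^+ 2 + 2 * d + 2 <= x,
      m%:R <= d * x / 2, d * x / 2 - 1 <= m%:R,
      k%:R <= kap * l / d * x & kap * l / d * x - 1 <= k%:R].

Lemma admissible_l_ge (R : realType) (l e kap : R) (A : admissible l e kap) :
  10 ^+ 7 <= l.
Proof.
have [e0 e12 hel hkap1 hkap2] := A.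
have e41 : e ^+ 4 <= 1 by apply: exprn_ile1; lra.
have l0 : 0 <= l.
  rewrite leNgt; apply/negP => l0.
  have : e ^+ 4 * l <= 0 by rewrite pmulr_rle0 ?exprn_gt0// ltW.
  have := hel; have : (0 : R) < 10 ^+ 7 by rewrite exprn_gt0.
  lra.
apply: le_trans hel _; rewrite ler_piMl//.
Qed.

Lemma admissible_e2l_ge (R : realType) (l e kap : R) (A : admissible l e kap) :
  10 ^+ 7 <= e ^+ 2 * l.
Proof.
have [e0 e12 hel hkap1 hkap2] := A.
apply: le_trans hel _; rewrite (exprD e 2 2) -mulrA ler_piMl//.
  by rewrite mulr_ge0 ?sqr_ge0//; apply: le_trans (admissible_l_ge A); rewrite exprn_ge0.
by apply: exprn_ile1; lra.
Qed.

(** Vertex classes will have size at least d / (8 l); this makes the loss 8 l negligible against the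
    margin d^(e^2/100). *)
Lemma l_le_expR_e2l (R : realType) (l e kap : R) (A : admissible l e kap) :
  8 * l <= expR (e ^+ 2 * l / 100).
Proof.
have [e0 e12 hel hkap1 hkap2] := A.
have l7 := admissible_l_ge A; have e2l := admissible_e2l_ge A.
apply: le_trans (expR_ge_cube _); last by lra.
have -> : (e ^+ 2 * l / 100 / 3) ^+ 3 = (e ^+ 4 * l) * (e ^+ 2 * l) * l / 300 ^+ 3 by field.
have h : (10 ^+ 7) * (10 ^+ 7) <= (e ^+ 4 * l) * (e ^+ 2 * l).
  by apply: ler_pM.
have : (10 ^+ 7) * (10 ^+ 7) * l <= (e ^+ 4 * l) * (e ^+ 2 * l) * l.
  by apply: ler_wpM2r => //; lra.
lra.
Qed.

(** The left side will bound rho / b, where rho <= d^(1 - e/4) and b >= d / (8 l). *)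
Lemma l_expRN_le_slack (R : realType) (l e kap : R) (A : admissible l e kap)
    (zeta := slack e) : 8 * l * expR (- (e * l / 4)) <= zeta ^+ 2 / 256.
Proof.
have [e0 e12 hel hkap1 hkap2] := A.
have l7 := admissible_l_ge A; have e2l := admissible_e2l_ge A.
have el0 : 0 <= e * l / 4 by rewrite divr_ge0// mulr_ge0//; lra.
rewrite expRN ler_pdivrMr ?expR_gt0//.
apply: le_trans (ler_wpM2l _ (expR_ge_cube el0)); last first.
  by apply: divr_ge0; [exact: sqr_ge0|exact: ler0n].
have -> : zeta ^+ 2 / 256 * (e * l / 4 / 3) ^+ 3 =
  (e ^+ 4 * l) * (e ^+ 3 * l) * l / (200 ^+ 2 * 256 * 12 ^+ 3) by rewrite /zeta /slack; field.
have h3 : e ^+ 4 * l <= e ^+ 3 * l.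
  by apply: ler_wpM2r; [lra|rewrite exprS ler_piMl ?exprn_ge0//; lra].
have h : (10 ^+ 7) * (10 ^+ 7) <= (e ^+ 4 * l) * (e ^+ 3 * l).
  by apply: ler_pM => //; apply: le_trans h3.
have : (10 ^+ 7) * (10 ^+ 7) * l <= (e ^+ 4 * l) * (e ^+ 3 * l) * l.
  by apply: ler_wpM2r => //; lra.
lra.
Qed.

Lemma slack_itv (R : realType) (l e kap : R) (A : admissible l e kap)
    (zeta := slack e) : 0 < zeta <= 1/800.
Proof.
have [e0 e12 hel hkap1 hkap2] := A.
apply/andP; split; first by rewrite divr_gt0// exprn_gt0.
rewrite /zeta /slack.
have : e ^+ 2 <= (2^-1) ^+ 2 by apply: lerXn2r => //; rewrite nnegrE ?ltW.
lra.
Qed.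

(** The three factors [1 + zeta] come from the raised edge density, from replacing 1 - p by an
    exponential, and from the extra classes. The bound [kap <= 2 - e] leaves room for all of
    them. *)
Lemma slack_cube_le (R : realType) (l e kap : R) (A : admissible l e kap)
    (zeta := slack e) : (1 + zeta) ^+ 3 * (kap / 2) <= 1 - e / 4.
Proof.
have [e0 e12 hel hkap1 hkap2] := A.
have /andP[z0 z1] : 0 < zeta <= 1/800 := slack_itv A.
have ze : zeta <= e / 400.
  have : e ^+ 2 <= e * 2^-1 by rewrite expr2 ler_wpM2l// ltW.
  rewrite /zeta /slack; lra.
have h : (1 + zeta) ^+ 3 <= 1 + 4 * zeta.
  have -> : (1 + zeta) ^+ 3 = 1 + 3 * zeta + zeta * zeta * (3 + zeta) by ring.
  have : zeta * (zeta * (3 + zeta)) <= zeta * 1 by apply: ler_wpM2l; nra.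
  rewrite mulrA; lra.
apply: (@le_trans _ _ ((1 + 4 * zeta) * (kap / 2))); first by apply: ler_wpM2r => //; lra.
nra.
Qed.

(** The exponent of the first moment is quadratic in the number of classes, hence one more factor
    [1 + zeta]. *)
Lemma slack_fourth_le (R : realType) (l e kap : R) (A : admissible l e kap)
    (zeta := slack e) : (1 + zeta) ^+ 4 * (kap / 2) <= kap / 2 + e ^+ 2 / 40.
Proof.
have [e0 e12 hel hkap1 hkap2] := A.
have /andP[z0 z1] : 0 < zeta <= 1/800 := slack_itv A.
have h : (1 + zeta) ^+ 4 <= 1 + 5 * zeta.
  have -> : (1 + zeta) ^+ 4 = 1 + 4 * zeta + zeta * (zeta * (6 + 4 * zeta + zeta * zeta)) by ring.
  have : zeta * (zeta * (6 + 4 * zeta + zeta * zeta)) <= zeta * 1.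
    by apply: ler_wpM2l; nra.
  lra.
apply: (@le_trans _ _ ((1 + 5 * zeta) * (kap / 2))); first by apply: ler_wpM2r => //; lra.
have -> : e ^+ 2 / 40 = 5 * zeta by rewrite /zeta /slack; field.
nra.
Qed.

Lemma l_le_expR (R : realType) (l e kap : R) (A : admissible l e kap) :
  8 * l <= expR l.
Proof.
have [e0 e12 hel hkap1 hkap2] := A.
apply: le_trans (l_le_expR_e2l A) _; rewrite ler_expR; have := admissible_l_ge A => l7.
have : e ^+ 2 <= 1 by apply: exprn_ile1; lra.
nra.
Qed.

Lemma large_size_n_ge (R : realType) (l e kap : R) (n m k : nat)
    (A : admissible l e kap) (L : large_size l e kap n m k)
    (zeta := slack e) (d := expR l) (x := n%:R : R) :
  [/\ 2 * d / zeta <= x, 8 / zeta + 16 / zeta ^+ 2 <= x & 2 * d + 2 <= x].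
Proof.
have [e0 e12 hel hkap1 hkap2] := A.
have [hn hm1 hm2 hk1 hk2] := L.
rewrite -/zeta -/d -/x in hn hm1 hm2 hk1 hk2.
have /andP[z0 _] : 0 < zeta <= 1/800 := slack_itv A.
have d0 := expR_gt0 l.
have h1 : 0 < d / zeta by rewrite divr_gt0.
have h2 : 0 < 8 / zeta by rewrite divr_gt0.
have h3 : 0 < 16 / zeta ^+ 2 by rewrite divr_gt0 ?exprn_gt0.
move: hn; rewrite -!mulrA; rewrite -/d in d0 *.
by split; lra.
Qed.

Lemma large_size_k_itv (R : realType) (l e kap : R) (n m k : nat)
    (A : admissible l e kap) (L : large_size l e kap n m k)
    (zeta := slack e) (d := expR l) (x := n%:R : R) :
  x / d <= k%:R /\ k%:R * d <= 2 * l * x.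
Proof.
have [e0 e12 hel hkap1 hkap2] := A.
have [hn hm1 hm2 hk1 hk2] := L.
rewrite -/zeta -/d -/x in hn hm1 hm2 hk1 hk2.
have [_ _ h3] :
    [/\ 2 * d / zeta <= x, 8 / zeta + 16 / zeta ^+ 2 <= x & 2 * d + 2 <= x] :=
  large_size_n_ge A L.
have l7 := admissible_l_ge A; have d0 := expR_gt0 l; rewrite -/d in d0.
split.
  apply: le_trans hk2.
  have xd1 : 1 <= x / d by rewrite ler_pdivlMr//; lra.
  have -> : kap * l / d * x = kap * l * (x / d) by field; rewrite gt_eqF.
  have kl : 2 <= kap * l by nra.
  nra.
rewrite -ler_pdivlMr//; apply: le_trans hk1 _.
have -> : kap * l / d * x = kap * (l * x / d) by ring.
have -> : 2 * l * x / d = 2 * (l * x / d) by ring.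
apply: ler_wpM2r; last lra.
by apply: divr_ge0; [apply: mulr_ge0 => //; lra|lra].
Qed.

(** Ensures that rounding [zeta * k] down loses at most half of it. *)
Lemma large_size_slack_k (R : realType) (l e kap : R) (n m k : nat)
    (A : admissible l e kap) (L : large_size l e kap n m k)
    (zeta := slack e) (d := expR l) (x := n%:R : R) : 2 <= zeta * k%:R.
Proof.
have [e0 e12 hel hkap1 hkap2] := A.
have [hn hm1 hm2 hk1 hk2] := L.
rewrite -/zeta -/d -/x in hn hm1 hm2 hk1 hk2.
have [h1 _ _] :
    [/\ 2 * d / zeta <= x, 8 / zeta + 16 / zeta ^+ 2 <= x & 2 * d + 2 <= x] :=
  large_size_n_ge A L.
have [hk _] : x / d <= k%:R /\ k%:R * d <= 2 * l * x := large_size_k_itv A L.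
have /andP[z0 _] : 0 < zeta <= 1/800 := slack_itv A.
have d0 := expR_gt0 l; rewrite -/d in d0.
have : 2 / zeta <= k%:R.
  apply: le_trans hk; rewrite ler_pdivlMr//; apply: le_trans h1.
  by rewrite le_eqVlt; apply/orP; left; apply/eqP; ring.
by rewrite ler_pdivrMr// mulrC.
Qed.

(** Chernoff with t = zeta / 2: as (1 + zeta) / (1 + zeta/2) >= 1 + zeta/4, the tilted mean still
    exceeds [m] by order zeta d n, and the exponent is at most -1. A constant probability is enough,
    since it costs only a factor 2 in the transfer. *)
Lemma binomial_has_m_edges (R : realType) (l e kap : R) (n m k : nat)
    (A : admissible l e kap) (L : large_size l e kap n m k)
    (zeta := slack e) (d := expR l) (x := n%:R : R) (p := (1 + zeta) * d / x) :
  0 <= p <= 1 ->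
  2^-1 <= bexp p (enum (pairs [set: 'I_n])) (fun S => (m <= #|S|)%N%:R).
Proof.
have [e0 e12 hel hkap1 hkap2] := A.
have [hn hm1 hm2 hk1 hk2] := L.
rewrite -/zeta -/d -/x in hn hm1 hm2 hk1 hk2.
move=> p01; have /andP[z0 z1] : 0 < zeta <= 1/800 := slack_itv A.
have d0 := expR_gt0 l; rewrite -/d in d0.
have l7 := admissible_l_ge A; have d8 : 8 * l <= d := l_le_expR A.
have [_ h2 h3] :
    [/\ 2 * d / zeta <= x, 8 / zeta + 16 / zeta ^+ 2 <= x & 2 * d + 2 <= x] :=
  large_size_n_ge A L.
have x0 : 0 < x by lra.
clear hel hn hm2 hk1 hk2.
have : bexp p (enum (pairs [set: 'I_n])) (fun S => (#|S| < m)%N%:R) <= 2^-1.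
  have t0 : 0 <= zeta / 2 by lra.
  apply: le_trans (bexp_card_lt _ _ p01 t0) _.
  apply: (@le_trans _ _ (expR (-1))); last first.
    rewrite expRN lef_pV2 ?posrE ?expR_gt0//.
    by apply: le_trans (expR_ge1Dx _); lra.
  rewrite ler_expR card_pairs cardsT card_ord bin2R -/x.
  have -> : p * (x * (x - 1) / 2) / (1 + zeta / 2) =
     (1 + zeta) / (1 + zeta / 2) * (d * (x - 1) / 2).
    by rewrite /p; field; apply/andP; split; apply/negP => /eqP; lra.
  have d1 : 1 <= d by lra.
  clear l7 d8.
  have hz : 1 + zeta / 4 <= (1 + zeta) / (1 + zeta / 2).
    by rewrite ler_pdivlMr; nra.
  have hd : 0 <= d * (x - 1) / 2 by apply: divr_ge0 => //; apply: mulr_ge0; lra.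
  have h := ler_wpM2r hd hz.
  set Q := (1 + zeta) / _ * _ in h *.
  have hQ : m%:R - Q <= d - zeta * d * x / 8.
    have : zeta * d <= 1 * d by apply: ler_wpM2r; lra.
    have E : (1 + zeta / 4) * (d * (x - 1) / 2) =
      d * x / 2 + zeta * d * x / 8 - d / 2 - zeta * d / 8 by field.
    rewrite E in h.
    have := hm1; lra.
  have hX : 8 / zeta + 16 / zeta ^+ 2 <= x by [].
  have h4 : zeta ^+ 2 / 16 * (8 / zeta + 16 / zeta ^+ 2) <= zeta ^+ 2 / 16 * x.
    by apply: ler_wpM2l => //; rewrite divr_ge0// sqr_ge0.
  have e4 : zeta ^+ 2 / 16 * (8 / zeta + 16 / zeta ^+ 2) = zeta / 2 + 1.
    by field; rewrite gt_eqF.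
  rewrite e4 in h4.
  have h5 : d * (zeta / 2 + 1) <= d * (zeta ^+ 2 / 16 * x) by apply: ler_wpM2l => //; lra.
  have : zeta / 2 * (m%:R - Q) <= zeta / 2 * (d - zeta * d * x / 8) by apply: ler_wpM2l.
  have -> : zeta / 2 * (d - zeta * d * x / 8) = zeta * d / 2 - d * (zeta ^+ 2 / 16 * x) by field.
  lra.
clear h2 h3 hm1.
set U := bexp _ _ _; set V := bexp _ _ _ => hU.
have UV : U + V = 1.
  rewrite /U /V -bexpD -[RHS](bexp_const p 1 (enum (pairs [set: 'I_n]))).
  apply: bexp_ext => S; case: ltnP => _ /=; lra.
lra.
Qed.

(** The main exponent comes from b^k, about d^k, times (1-p)^C(k,2), about d^(- k kap / 2). The term
    e^2 l k / 20 collects all losses. *)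
Lemma many_indep_whp (R : realType) (l e kap : R) (n m k : nat)
    (A : admissible l e kap) (L : large_size l e kap n m k) (zeta := slack e) :
  #|[set E in graphs_nm n m | (#|indep_k E k|%:R <
       2^-1 * expR (k%:R * l * (1 - kap / 2) - e ^+ 2 / 20 * l * k%:R))%R]|%:R /
    #|graphs_nm n m|%:R <= 8 * expR (- (zeta ^+ 2 * k%:R / 128)).
Proof.
have [e0 e12 hel hkap1 hkap2] := A.
have L' : large_size l e kap n m k := L.
case: L'; set d := expR l; rewrite -/zeta; set x : R := n%:R => hn hm1 hm2 hk1 hk2.
have /andP[z0 z1] : 0 < zeta <= 1/800 := slack_itv A.
have d0 : 0 < d := expR_gt0 l.
have l7 := admissible_l_ge A; have d8 : 8 * l <= d := l_le_expR A.
have [h1 h2 h3] :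
    [/\ 2 * d / zeta <= x, 8 / zeta + 16 / zeta ^+ 2 <= x & 2 * d + 2 <= x] :=
  large_size_n_ge A L.
have [hk3 hk4] : x / d <= k%:R /\ k%:R * d <= 2 * l * x := large_size_k_itv A L.
have hzk : 2 <= zeta * k%:R := large_size_slack_k A L.
have l20 : 20 <= l by lra.
clear hel hn hm1 hm2 hk2 l7 h2.
have x0 : 0 < x by lra.
have kR0 : 0 < k%:R :> R.
  by rewrite -(pmulr_rgt0 _ z0); lra.
have k0 : (0 < k)%N by rewrite -(ltr0n R).
(* The number of surplus classes, which may be discarded at the end. *)
set r := Num.truncn (zeta * k%:R).
have r1 : r%:R <= zeta * k%:R by rewrite truncn_le; lra.
have r2 : zeta * k%:R / 2 <= r%:R.
  have := truncnS_gt (zeta * k%:R); rewrite -/r -natr1; lra.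
(* The predecessor, because [edge_color] works with [K.+1] classes. *)
set K := (k + r).-1.
have KE : K.+1 = (k + r)%N by rewrite /K prednK// addn_gt0 k0.
have KR : K.+1%:R = k%:R + r%:R :> R by rewrite KE natrD.
have rK : (r <= K.+1)%N by rewrite KE leq_addl.
have kE : (K.+1 - r)%N = k by rewrite KE addnK.
have K1 : K.+1%:R <= (1 + zeta) * k%:R :> R by rewrite KR; lra.
have K2 : K.+1%:R <= 2 * k%:R :> R by nra.
have K3 : K.+1%:R * d <= 4 * l * x.
  have : K.+1%:R * d <= 2 * k%:R * d by apply: ler_wpM2r => //; lra.
  lra.
have K4 : K.+1%:R <= x.
  have : K.+1%:R * d <= x * d.
    apply: le_trans K3 _; rewrite mulrC; apply: ler_wpM2l; lra.
  by rewrite ler_pM2r.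
clear h3 hk3 hk4 d8.
have Kn : (K.+1 <= n)%N by rewrite -(ler_nat R).
have KR0 : 0 < K.+1%:R :> R by rewrite ltr0n.
set b := (n %/ K.+1)%N.
have b0 : (0 < b)%N by rewrite divn_gt0.
have bR0 : 0 < b%:R :> R by rewrite ltr0n.
have bn : (K.+1 * b <= n)%N by rewrite mulnC leq_divM.
have bx : x <= 2 * (b%:R * K.+1%:R).
  rewrite -natrM -(natrM _ 2) ler_nat.
  have : (n < b.+1 * K.+1)%N by rewrite -ltn_divLR.
  by move: b0; clear; nia.
set p := (1 + zeta) * d / x.
have p_le : p * (1 + zeta) <= zeta.
  have : 2 * d <= x * zeta by rewrite -ler_pdivrMr.
  move=> h; rewrite /p mulrAC ler_pdivrMr//.
  have : (1 + zeta) * (1 + zeta) <= 2 by nra.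
  nra.
clear h1.
have p0 : 0 < p by rewrite divr_gt0// mulr_gt0//; lra.
have p1 : p < 1 by nra.
have p01 : 0 <= p < 1 by rewrite p1 ltW.
have p01' : 0 <= p <= 1 by rewrite !ltW.
(* [eta] is p (1 + zeta). Since p (1 + zeta) <= zeta, it is at least p / (1 - p), which gives 1 - p
   >= exp(-eta). *)
set eta := (1 + zeta) ^+ 2 * d / x.
have eta0 : 0 < eta by rewrite divr_gt0// mulr_gt0// exprn_gt0//; lra.
have q_ge : expR (- eta) <= 1 - p.
  have q0 : 0 < 1 - p by lra.
  have : (1 - p)^-1 <= expR eta.
    apply: le_trans (expR_ge1Dx _).
    have -> : (1 - p)^-1 = 1 + p / (1 - p) by field; rewrite gt_eqF.
    rewrite lerD2l ler_pdivrMr//.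
    have -> : eta = p * (1 + zeta) by rewrite /eta /p; field; rewrite gt_eqF.
    nra.
  by move=> hq; rewrite expRN -[leRHS]invrK lef_pV2 ?posrE ?expR_gt0 ?invr_gt0.
clear p_le.
(* (1-p)^C(s,2) is at least exp(- eta s (s-1) / 2), and s - 1 is at most the number of classes. *)
set rho := expR (eta * K.+1%:R / 2).
have Hrho s : (s <= K.+1)%N -> 1 <= rho ^+ s * (1 - p) ^+ 'C(s, 2).
  move=> sK; apply: (@le_trans _ _ (rho ^+ s * expR (- eta) ^+ 'C(s, 2))); last first.
    by apply: ler_wpM2l; [exact: exprn_ge0 (expR_ge0 _)|];
      apply: lerXn2r; rewrite ?nnegrE ?expR_ge0//; lra.
  rewrite /rho -!expRM_natl -expRD -[leLHS]expR0 ler_expR bin2R.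
  have sR : s%:R <= K.+1%:R :> R by rewrite ler_nat.
  have s0 : 0 <= s%:R :> R by [].
  have -> : s%:R * (eta * K.+1%:R / 2) + s%:R * (s%:R - 1) / 2 * - eta =
     s%:R * eta * (K.+1%:R - s%:R + 1) / 2 by field.
  by apply: divr_ge0 => //; apply: mulr_ge0; [apply: mulr_ge0 => //; exact: ltW|lra].
have etaK : eta * K.+1%:R / 2 <= (1 + zeta) ^+ 3 * (kap / 2) * l.
  have -> : eta = (1 + zeta) ^+ 2 * (d / x) by rewrite /eta; ring.
  have : d / x * K.+1%:R <= (1 + zeta) * (kap * l).
    apply: (@le_trans _ _ (d / x * ((1 + zeta) * (kap * l / d * x)))).
      apply: ler_wpM2l; first by rewrite divr_ge0// ltW.
      by apply: le_trans K1 _; apply: ler_wpM2l => //; lra.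
    by rewrite le_eqVlt; apply/orP; left; apply/eqP; field; rewrite !gt_eqF.
  move=> h; have : (1 + zeta) ^+ 2 * (d / x * K.+1%:R) <=
      (1 + zeta) ^+ 2 * ((1 + zeta) * (kap * l)).
    by apply: ler_wpM2l => //; exact: sqr_ge0.
  lra.
have l0 : 0 <= l by lra.
have rhob : rho / b%:R <= zeta ^+ 2 / 256.
  apply: le_trans (l_expRN_le_slack A).
  have e1 : rho <= d * expR (- (e * l / 4)).
    rewrite /rho /d -expRD ler_expR; apply: le_trans etaK _.
    have := ler_wpM2r l0 (slack_cube_le A); rewrite -/zeta; lra.
  rewrite ler_pdivrMr//.
  apply: le_trans e1 _.
  have -> : 8 * l * expR (- (e * l / 4)) * b%:R = (8 * l * b%:R) * expR (- (e * l / 4)) by ring.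
  apply: ler_wpM2r; first exact: expR_ge0.
  have : K.+1%:R * d <= 4 * l * (2 * (b%:R * K.+1%:R)).
    by apply: le_trans K3 _; apply: ler_wpM2l => //; lra.
  have -> : 4 * l * (2 * (b%:R * K.+1%:R)) = K.+1%:R * (8 * l * b%:R) by ring.
  by rewrite ler_pM2l.
have rho0 : 0 <= rho by exact: expR_ge0.
have hbin := @many_indep_binomial R n K r b p rho bn b0 rK p01 rho0 Hrho.
rewrite kE in hbin.
set a := b%:R ^+ k * (1 - p) ^+ 'C(K.+1, 2) / 2 in hbin.
set a0 := 2^-1 * _.
(* The class size loses e^2/100 and the factors [1 + zeta] lose e^2/40, together less than
   e^2/20. *)
have a0a : a0 <= a.
  clear - A e0 z0 z1 kR0 etaK K3 K1 KR0 bR0 d0 l20 eta0 l0 q_ge bx k0 p0 p1.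
  rewrite /a0 /a mulrC; apply: ler_wpM2r => //.
  have b_ge : expR (l - e ^+ 2 * l / 100) <= b%:R.
    rewrite expRD expRN ler_pdivrMr ?expR_gt0// -/d.
    apply: (@le_trans _ _ (b%:R * (8 * l))); last first.
      by apply: ler_wpM2l; [exact: ltW|exact: l_le_expR_e2l A].
    have : K.+1%:R * d <= 4 * l * (2 * (b%:R * K.+1%:R)).
      by apply: le_trans K3 _; apply: ler_wpM2l => //; lra.
    have -> : 4 * l * (2 * (b%:R * K.+1%:R)) = K.+1%:R * (b%:R * (8 * l)) by ring.
    by rewrite ler_pM2l.
  apply: (@le_trans _ _ (expR (l - e ^+ 2 * l / 100) ^+ k *
      expR (- eta) ^+ 'C(K.+1, 2))); last first.
    apply: ler_pM; rewrite ?exprn_ge0 ?expR_ge0//;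
      apply: lerXn2r; rewrite ?nnegrE ?expR_ge0 ?(ltW bR0)//; lra.
  rewrite -!expRM_natl -expRD ler_expR bin2R.
  have e2 : eta * K.+1%:R * (K.+1%:R - 1) / 2 <= (kap / 2 + e ^+ 2 / 40) * l * k%:R.
    have e20 : 0 <= eta * K.+1%:R / 2 by apply: divr_ge0 => //; apply: mulr_ge0; exact: ltW.
    have e3 : eta * K.+1%:R / 2 * K.+1%:R <= (1 + zeta) ^+ 3 * (kap / 2) * l * ((1 + zeta) * k%:R).
      by apply: ler_pM.
    have e4 : (1 + zeta) ^+ 4 * (kap / 2) * (l * k%:R) <= (kap / 2 + e ^+ 2 / 40) * (l * k%:R).
      by apply: ler_wpM2r; [apply: mulr_ge0 => //; exact: ltW|exact: slack_fourth_le A].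
    lra.
  have e5 : 0 <= e ^+ 2 * l * k%:R by rewrite !mulr_ge0 ?sqr_ge0// ltW.
  have -> : K.+1%:R * (K.+1%:R - 1) / 2 * - eta = - (eta * K.+1%:R * (K.+1%:R - 1) / 2) by ring.
  lra.
clear k0 etaK l0 hk1 K1 K3 K4 bx b0 bn q_ge eta0 hkap1 hkap2 e0 e12 l20 Kn KE x0 d0.
have hU := @many_indep_uniform R n m k p a0 p01'.
have hE := @binomial_has_m_edges R l e kap n m k A L p01'.
have hmono : bexp p (enum (pairs [set: 'I_n])) (fun E => (#|indep_k E k|%:R < a0)%R%:R) <=
   bexp p (enum (pairs [set: 'I_n])) (fun E => (#|indep_k E k|%:R < a)%R%:R).
  apply: ler_bexp => // E _; rewrite ler_nat; case: (ltP _ a0) => // h.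
  by rewrite (lt_le_trans h a0a).
set Pm := _ / _ in hU *.
have Pm0 : 0 <= Pm by rewrite divr_ge0.
have hPm : Pm * 2^-1 <= 4 * (1 + rho / b%:R) ^+ K.+1 * expR (- r%:R ^+ 2 / (8 * K.+1%:R)).
  apply: le_trans hbin; apply: le_trans hmono; apply: le_trans hU.
  by apply: ler_wpM2l.
clear - z0 z1 hzk kR0 K2 KR0 r2 rhob rho0 bR0 hPm.
(* The second-moment loss exp(zeta^2 k / 128) is only the square root of the isoperimetric gain
   exp(zeta^2 k / 64). *)
have f1 : (1 + rho / b%:R) ^+ K.+1 <= expR (zeta ^+ 2 * k%:R / 128).
  apply: (@le_trans _ _ (expR (rho / b%:R) ^+ K.+1)).
    by apply: lerXn2r; rewrite ?nnegrE ?expR_ge0 ?expR_ge1Dx// addr_ge0// divr_ge0// ltW.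
  rewrite -expRM_natl ler_expR.
  have : K.+1%:R * (rho / b%:R) <= 2 * k%:R * (zeta ^+ 2 / 256).
    by apply: ler_pM => //; rewrite divr_ge0// ltW.
  lra.
have f2 : expR (- r%:R ^+ 2 / (8 * K.+1%:R)) <= expR (- (zeta ^+ 2 * k%:R / 64)).
  rewrite ler_expR mulNr lerN2 ler_pdivlMr ?mulr_gt0//.
  have : (zeta * k%:R / 2) ^+ 2 <= r%:R ^+ 2.
    by apply: lerXn2r; rewrite ?nnegrE//; lra.
  have : zeta ^+ 2 * k%:R / 64 * (8 * K.+1%:R) <= zeta ^+ 2 * k%:R / 64 * (8 * (2 * k%:R)).
    apply: ler_wpM2l; first by rewrite divr_ge0// mulr_ge0 ?sqr_ge0// ltW.
    lra.
  have -> : zeta ^+ 2 * k%:R / 64 * (8 * (2 * k%:R)) = (zeta * k%:R / 2) ^+ 2 by field.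
  lra.
have f3 : 4 * (1 + rho / b%:R) ^+ K.+1 * expR (- r%:R ^+ 2 / (8 * K.+1%:R)) <=
    4 * expR (- (zeta ^+ 2 * k%:R / 128)).
  rewrite -mulrA ler_pM2l//.
  apply: (@le_trans _ _ (expR (zeta ^+ 2 * k%:R / 128) * expR (- (zeta ^+ 2 * k%:R / 64)))).
    apply: ler_pM => //; rewrite ?expR_ge0 ?exprn_ge0// addr_ge0// divr_ge0// ltW//.
  by rewrite -expRD ler_expR; lra.
lra.
Qed.

(** * The expected number of expandable pairs *)

Lemma large_size_m_le (R : realType) (l e kap : R) (n m k : nat)
    (A : admissible l e kap) (L : large_size l e kap n m k) : (m <= 'C(n, 2))%N.
Proof.
case: (L); set d := expR l; set x : R := n%:R => _ hm1 _ _ _.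
have [_ _ h3] := large_size_n_ge A L; rewrite -/d -/x in h3.
have d0 : 0 < d := expR_gt0 l.
rewrite -(ler_nat R) bin2R -/x; apply: le_trans hm1 _.
have : d * x <= (x - 1) * x by apply: ler_wpM2r; lra.
lra.
Qed.

(** A condition free of gamma and delta. Adding the two size bounds of [expandable] cancels gamma,
    and 2 - 2 (eps - e) / (1 + eps) = (2 + 2 e) / kap. *)
Definition expansion (R : realType) (e kap : R) (n : nat) (S t : {set 'I_n}) : bool :=
  ((1 + e) * #|S|%:R <= #|t|%:R) &&
  ((2 + 2 * e) * #|S|%:R <= kap * (#|t|%:R + #|t :&: S|%:R)).

Lemma expandable_expansion (R : realType) (n : nat) (E : {set {set 'I_n}})
    (S : {set 'I_n}) (e eps gamma delta : R) : 0 < 1 + eps ->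
  e < gamma -> delta < gamma + 2 * (eps - e) / (1 + eps) ->
  expandable E S gamma delta ->
  exists2 t, independent E t & expansion e (1 + eps) S t.
Proof.
move=> k0 eg dg [t [it [h1 h2]]]; exists t => //.
set s := #|S|%:R in h1 h2 *; have s0 : 0 <= s by rewrite ler0n.
have eg' : e * s <= gamma * s by apply: ler_wpM2r => //; exact: ltW.
apply/andP; split; first by rewrite -/s; lra.
rewrite -/s; apply: (@le_trans _ _ ((1 + eps) * ((1 + gamma) * s + (1 - delta) * s))); last first.
  by apply: ler_wpM2l; lra.
have : (1 + eps) * delta <= (1 + eps) * gamma + 2 * (eps - e).
  have := ler_wpM2l (ltW k0) (ltW dg).
  have -> : (1 + eps) * (gamma + 2 * (eps - e) / (1 + eps)) = (1 + eps) * gamma + 2 * (eps - e).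
    by field; rewrite gt_eqF.
  by [].
move=> /(ler_wpM2r s0); lra.
Qed.

(** The error 5 k consists of one k each from C(n, k), from (1 + 1/d)^n and from 2^k, and of 2 k
    from rounding in the edge term. *)
Lemma planted_ratio (R : realType) (l e kap : R) (n m k : nat)
    (A : admissible l e kap) (L : large_size l e kap n m k) :
  (\sum_(E in graphs_nm n m)
     #|[set S in indep_k E k | [exists t, independent E t && expansion e kap S t]]|)%:R /
    #|graphs_nm n m|%:R <=
  expR (k%:R * l * (1 - kap / 2) - e ^+ 2 * l * k%:R / 2 + 5 * k%:R).
Proof.
have [e0 e12 hel hkap1 hkap2] := A.
have mN := large_size_m_le A L.
case: (L); set d := expR l; set x : R := n%:R => hn hm1 hm2 hk1 hk2.
have d0 : 0 < d := expR_gt0 l.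
have l7 := admissible_l_ge A; have d8 : 8 * l <= d := l_le_expR A.
have el7 := admissible_e2l_ge A.
have [h1 h2 h3] := large_size_n_ge A L; rewrite -/d -/x in h1 h2 h3.
have [hk3 hk4] : x / d <= k%:R /\ k%:R * d <= 2 * l * x := large_size_k_itv A L.
have x0 : 0 < x by lra.
have k1 : 1 <= k%:R :> R.
  by apply: le_trans hk3; rewrite ler_pdivlMr//; lra.
have kx : k%:R <= x.
  have : k%:R * d <= x * d by apply: le_trans hk4 _; rewrite mulrC; apply: ler_wpM2l; lra.
  by rewrite ler_pM2r.
have N0' : 0 < 'C(n, 2)%:R :> R.
  by rewrite bin2R -/x divr_gt0// mulr_gt0//; lra.
have N0 : (0 < 'C(n, 2))%N by rewrite -(ltr0n R).
set mu : R := m%:R / 'C(n, 2)%:R.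
have mu_ge : d / x - 2 / x ^+ 2 <= mu.
  rewrite /mu ler_pdivlMr// bin2R -/x.
  have -> : (d / x - 2 / x ^+ 2) * (x * (x - 1) / 2) = (d * x / 2 - 1) - (d - 2 / x) / 2.
    by field; rewrite gt_eqF.
  have : 2 / x <= d by rewrite ler_pdivrMr//; nra.
  lra.
have el2 : 2 * 10 <= e * l.
  have : e ^+ 2 * l <= e * 2^-1 * l.
    by apply: ler_wpM2r; [lra|rewrite expr2; apply: ler_wpM2l; lra].
  lra.
have l20 : 20 <= l by lra.
clear hel hn hm1 l7 el7.
have Hc (S t : {set 'I_n}) : #|S| = k -> expansion e kap S t ->
     e * k%:R <= #|t :\: S|%:R /\
     l * (1 + e / 2) <= mu * (#|t|%:R + #|t :&: S|%:R - 1) / 2.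
  move=> cS /andP[]; rewrite cS.
  have ts : #|t|%:R = #|t :&: S|%:R + #|t :\: S|%:R :> R by rewrite -natrD cardsID.
  have sk : #|t :&: S|%:R <= k%:R :> R by rewrite -cS ler_nat subset_leq_card// subsetIr.
  have tx : #|t|%:R <= x by rewrite ler_nat -[n in (_ <= n)%N]card_ord max_card.
  move=> c1 c2; split; first by lra.
  set T := #|t|%:R + #|t :&: S|%:R in c2 *.
  have T2 : T <= 2 * x by rewrite /T; lra.
  have kk : l * x / d - 1 <= k%:R / kap.
    rewrite ler_pdivlMr; last lra.
    have -> : (l * x / d - 1) * kap = kap * l / d * x - kap by ring.
    lra.
  (* The 4 covers 2 + 2 e <= 3 from the rounding of [k], and the 1 subtracted from [T]. *)
  have T1 : (2 + 2 * e) * (l * x / d) - 4 <= T - 1.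
    have : (2 + 2 * e) * (k%:R / kap) <= T.
      by rewrite mulrA ler_pdivrMr; [rewrite mulrC|lra]; lra.
    have : (2 + 2 * e) * (l * x / d - 1) <= (2 + 2 * e) * (k%:R / kap) by apply: ler_wpM2l; lra.
    lra.
  have T0 : 0 <= T - 1.
    apply: le_trans T1.
    have lx : 10 <= l * x / d by rewrite ler_pdivlMr//; nra.
    have : 0 <= e * (l * x / d) by apply: mulr_ge0; lra.
    lra.
  have s1 : (d / x - 2 / x ^+ 2) * (T - 1) <= mu * (T - 1) by apply: ler_wpM2r.
  have s2 : d / x * ((2 + 2 * e) * (l * x / d) - 4) <= d / x * (T - 1).
    by apply: ler_wpM2l => //; rewrite divr_ge0// ltW.
  have s3 : 2 / x ^+ 2 * (T - 1) <= 2 / x ^+ 2 * (2 * x).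
    by apply: ler_wpM2l; [rewrite divr_ge0// sqr_ge0|lra].
  have E1 : d / x * ((2 + 2 * e) * (l * x / d) - 4) = (2 + 2 * e) * l - 4 * (d / x).
    by field; rewrite !gt_eqF.
  have E2 : 2 / x ^+ 2 * (2 * x) = 4 / x by field; rewrite gt_eqF.
  rewrite E1 in s2; rewrite E2 in s3.
  (* The errors in mu (T - 1) add up to at most 2, and half the surplus [e * l >= 20] covers
     them. *)
  have : (2 * d + 2) / x <= 1 by rewrite ler_pdivrMr// mul1r.
  have -> : (2 * d + 2) / x = 2 * (d / x) + 2 / x by ring.
  move=> s4; lra.
have l0 : 0 <= l by lra.
apply: le_trans (planted_first_moment N0 mN l0 (ltW e0) Hc) _; rewrite -/mu.
have xd : x * expR (- l) <= k%:R by rewrite expRN.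
have b1 : 'C(n, k)%:R <= expR (k%:R * l + k%:R).
  by apply: le_trans (@bin_le_expR R n k l) _; rewrite ler_expR lerD2l.
have b2 : (1 + expR (- l)) ^+ n <= expR k%:R.
  apply: (@le_trans _ _ (expR (expR (- l)) ^+ n)).
    by apply: lerXn2r; rewrite ?nnegrE ?expR_ge0 ?expR_ge1Dx// addr_ge0// expR_ge0.
  by rewrite -expRM_natl ler_expR.
have b3 : 2 ^+ k <= expR k%:R :> R.
  rewrite -[X in expR X]mulr1 expRM_natl; apply: lerXn2r; rewrite ?nnegrE ?expR_ge0//.
  by apply: le_trans (expR_ge1Dx _); lra.
have muK : kap * l * k%:R / 2 - 2 * k%:R <= mu * 'C(k, 2)%:R.
  rewrite bin2R.
  have u1 : (d / x - 2 / x ^+ 2) * (k%:R - 1) <= mu * (k%:R - 1) by apply: ler_wpM2r; lra.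
  have u2 : d / x * (kap * l / d * x - 2) <= d / x * (k%:R - 1).
    by apply: ler_wpM2l; [rewrite divr_ge0// ltW|lra].
  have u3 : 2 / x ^+ 2 * (k%:R - 1) <= 2 / x ^+ 2 * x.
    by apply: ler_wpM2l; [rewrite divr_ge0// sqr_ge0|lra].
  have E1 : d / x * (kap * l / d * x - 2) = kap * l - 2 * (d / x).
    by field; rewrite !gt_eqF.
  have E2 : 2 / x ^+ 2 * x = 2 / x by field; rewrite gt_eqF.
  rewrite E1 in u2; rewrite E2 in u3.
  have : (2 * d + 2) / x <= 1 by rewrite ler_pdivrMr// mul1r.
  have -> : (2 * d + 2) / x = 2 * (d / x) + 2 / x by ring.
  move=> s4; have u5 : kap * l - 4 <= mu * (k%:R - 1) by lra.
  have : k%:R * (kap * l - 4) <= k%:R * (mu * (k%:R - 1)) by apply: ler_wpM2l.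
  lra.
apply: (@le_trans _ _ (expR (k%:R * l + k%:R) *
    expR (- (mu * 'C(k, 2)%:R) - e ^+ 2 * l * k%:R / 2) * (expR k%:R * expR k%:R))).
  apply: ler_pM.
  - by rewrite mulr_ge0// expR_ge0.
  - by rewrite mulr_ge0// exprn_ge0// addr_ge0// expR_ge0.
  - by apply: ler_wpM2r => //; exact: expR_ge0.
  - by apply: ler_pM => //; rewrite exprn_ge0// addr_ge0// expR_ge0.
by rewrite -!expRD ler_expR; lra.
Qed.

(** Bad pairs carry exp(- e^2 l k / 2), the lower bound on independent sets only exp(- e^2 l k /
    20). As e^2 l >= 10^7, the difference absorbs 5 k and leaves exp(-k); the factor 2 undoes the
    [2^-1] in [a0]. *)
Lemma not_expandable_prob (R : realType) (l e eps : R) (n m k : nat)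
    (A : admissible l e (1 + eps)) (L : large_size l e (1 + eps) n m k)
    (P : {set {set 'I_n}} -> {set 'I_n} -> bool) :
  (forall E S, ~~ P E S -> exists gamma delta : R, [/\ e < gamma,
     delta < gamma + 2 * (eps - e) / (1 + eps) & expandable E S gamma delta]) ->
  1 - (8 * expR (- (slack e ^+ 2 * k%:R / 128)) + 2 * expR (- k%:R)) <= probU R m k P.
Proof.
move=> HP; have [e0 e12 hel hkap1 hkap2] := A.
have el7 := admissible_e2l_ge A.
have mN := large_size_m_le A L.
set kap := 1 + eps in A L hkap1 hkap2 *.
set a0 : R := 2^-1 * expR (k%:R * l * (1 - kap / 2) - e ^+ 2 / 20 * l * k%:R).
have a00 : 0 < a0 by rewrite mulr_gt0// expR_gt0.
have HP' E S : S \in indep_k E k -> ~~ P E S ->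
    exists2 t, independent E t & expansion e kap S t.
  move=> _ /HP[gamma [delta [h1 h2 h3]]].
  by apply: (expandable_expansion _ h1 h2 h3); rewrite -/kap; lra.
apply: le_trans (probU_lower_bound mN a00 HP').
rewrite lerD2l lerN2; apply: lerD; first exact: many_indep_whp A L.
rewrite ler_pdivrMr//; apply: le_trans (planted_ratio A L) _.
have -> : 2 * expR (- k%:R) * a0 =
   expR (- k%:R) * expR (k%:R * l * (1 - kap / 2) - e ^+ 2 / 20 * l * k%:R).
  by rewrite /a0; field.
rewrite -expRD ler_expR.
have : 10 ^+ 7 * k%:R <= e ^+ 2 * l * k%:R by apply: ler_wpM2r.
have : 0 <= k%:R :> R by [].
lra.
Qed.

(** * The choice of the function of [d] and the limit in [n] *)

Lemma expRN_le_inv (R : realType) (y : R) : 0 < y -> expR (- y) <= y^-1.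
Proof.
move=> y0; rewrite expRN lef_pV2 ?posrE ?expR_gt0//.
by apply: le_trans (expR_ge1Dx y); rewrite lerDr.
Qed.

(* The constant gives [eps_d d ^ 4 * ln d = 10 ^ 8].  For [d <= 1] the value 1
   makes the range of [eps] empty. *)
Definition eps_d (R : realType) (d : R) : R :=
  if 1 < d then 100 / Num.sqrt (Num.sqrt (ln d)) else 1.

Lemma eps_d_admissible (R : realType) (d eps : R) : eps_d d <= eps ->
  eps <= 1 - eps_d d -> 0 < ln d /\ admissible (ln d) (eps_d d) (1 + eps).
Proof.
(* A nonempty range for [eps] forces this bound, which excludes the default value 1 and so gives d >
   1. *)
move=> h1 h2; have e12 : eps_d d <= 2^-1 by lra.
have d1 : 1 < d.
  by rewrite ltNge; apply/negP => d1; move: e12; rewrite /eps_d ltNge d1 /=; lra.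
have l0 : 0 < ln d by rewrite ln_gt0.
split=> //; have s0 : 0 < Num.sqrt (ln d) by rewrite sqrtr_gt0.
have t0 : 0 < Num.sqrt (Num.sqrt (ln d)) by rewrite sqrtr_gt0.
have E : eps_d d = 100 / Num.sqrt (Num.sqrt (ln d)) by rewrite /eps_d d1.
split; [by rewrite E divr_gt0|lra|rewrite E|lra|lra].
have -> : (100 / Num.sqrt (Num.sqrt (ln d))) ^+ 4 * ln d = 100 ^+ 4.
  have tE : Num.sqrt (Num.sqrt (ln d)) ^+ 4 = ln d.
    by rewrite -[4%N]/(2 * 2)%N exprM !sqr_sqrtr// ltW.
  by rewrite expr_div_n tE divfK// gt_eqF.
have -> : (100 : R) ^+ 4 = 10 ^+ 7 * 10 by ring.
by rewrite ler_peMr// ?exprn_ge0//; lra.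
Qed.

Lemma eps_d_cvg0 (R : realType) : (eps_d x @[x --> +oo%R] --> (0 : R))%classic.
Proof.
apply/cvgrPdist_le => e e0.
near=> x.
have x1 : 1 < x by near: x; apply: nbhs_pinfty_gt; rewrite num_real.
(* From here on the fourth root of [ln x] is at least 100 / e. *)
have xe : expR ((100 / e) ^+ 4) <= x.
  by near: x; apply: nbhs_pinfty_ge; rewrite num_real.
have lx : (100 / e) ^+ 4 <= ln x.
  by rewrite -[leLHS]expRK ler_ln ?posrE ?expR_gt0//; lra.
have h : 0 < 100 / e by rewrite divr_gt0.
have t : 100 / e <= Num.sqrt (Num.sqrt (ln x)).
  rewrite -[leLHS]ger0_norm ?(ltW h)// -sqrtr_sqr ler_wsqrtr//.
  rewrite -[leLHS]ger0_norm ?sqr_ge0// -sqrtr_sqr ler_wsqrtr//.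
  by rewrite -exprM.
have t0 := lt_le_trans h t.
rewrite /eps_d x1 sub0r normrN ger0_norm; last by rewrite divr_ge0// ltW.
by rewrite ler_pdivrMr// mulrC -ler_pdivrMr.
Unshelve. all: by end_near.
Qed.

Local Open Scope classical_set_scope.
Local Open Scope ring_scope.

Theorem theorem1p6 (R : realType) :
  exists epsd : R -> R,
    (epsd x @[x --> +oo] --> (0 : R)) /\
    forall (d eps : R), 0 < d ->
      epsd d <= eps -> eps <= 1 - epsd d ->
      let m : nat -> nat := fun n => Num.truncn (d * n%:R / 2) in
      let k : nat -> nat := fun n => Num.truncn ((1 + eps) * ln d / d * n%:R) in
      (fun n : nat =>
         @probU R n (m n) (k n)
           (fun E sigma =>
              `[< forall gamma delta : R, 0 <= gamma -> 0 <= delta ->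
                    epsd d < gamma ->
                    delta < gamma + 2 * (eps - epsd d) / (1 + eps) ->
                    ~ expandable E sigma gamma delta >]))
        @ \oo --> (1 : R).
Proof.
exists (@eps_d R); split; first exact: eps_d_cvg0.
move=> d eps d0 he1 he2 m k.
have [l0 A] := eps_d_admissible he1 he2.
have [e0 e12 _ hkap1 hkap2] := A.
set e := eps_d d in A e0 e12 hkap1 hkap2 *.
set zeta := slack e.
have /andP[z0 _] : 0 < zeta <= 1 / 800 := slack_itv A.
have dE : expR (ln d) = d by rewrite lnK.
pose X0 : R := 4 * d / zeta + 8 / zeta + 16 / zeta ^+ 2 + 2 * d + 2.
(* [D / n] bounds the total error: each exponential is estimated by exp(-y) <= 1/y with k >= n/d,
   and 1024 is 8 times 128. *)
pose D : R := 1024 * d / zeta ^+ 2 + 2 * d.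
apply/cvgrPdist_le => s s0; near=> n.
have hX : X0 <= n%:R by near: n; exact: nbhs_infty_ger.
have hD : D / s <= n%:R by near: n; exact: nbhs_infty_ger.
have trunc2 (y : R) : 0 <= y -> (Num.truncn y)%:R <= y /\ y - 1 <= (Num.truncn y)%:R.
  move=> y0; rewrite truncn_le y0; split=> //.
  by have := truncnS_gt y; rewrite -natr1; lra.
have [m1 m2] : (m n)%:R <= d * n%:R / 2 /\ d * n%:R / 2 - 1 <= (m n)%:R.
  by apply: trunc2; rewrite divr_ge0// mulr_ge0// ltW.
have [k1 k2] : (k n)%:R <= (1 + eps) * ln d / d * n%:R /\
    (1 + eps) * ln d / d * n%:R - 1 <= (k n)%:R.
  by apply: trunc2; rewrite mulr_ge0// divr_ge0 ?(ltW d0)// mulr_ge0 ?(ltW l0)//; lra.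
have L : large_size (ln d) e (1 + eps) n (m n) (k n) by rewrite /large_size dE.
set P := fun E sigma => _.
have h := @not_expandable_prob R (ln d) e eps n (m n) (k n) A L P.
have {}h := h _.
have hP E S : ~~ P E S -> exists gamma delta : R, [/\ e < gamma,
     delta < gamma + 2 * (eps - e) / (1 + eps) & expandable E S gamma delta].
  move=> /asboolPn; rewrite -existsNE => -[gamma]; rewrite -existsNE => -[delta].
  rewrite !not_implyE => -[_ [_ [h1 [h2 [h3 _]]]]].
  by exists gamma, delta.
have {hP}h := h hP.
rewrite ger0_norm; last by rewrite subr_ge0 probU_le1.
have x0 : 0 < n%:R :> R.
  have u1 : 0 < 4 * d / zeta by rewrite divr_gt0// mulr_gt0.
  have u2 : 0 < 8 / zeta by rewrite divr_gt0.
  have u3 : 0 < 16 / zeta ^+ 2 by rewrite divr_gt0// exprn_gt0.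
  by apply: lt_le_trans hX; rewrite /X0; lra.
have [hk _] := large_size_k_itv A L; rewrite dE in hk.
have xd : 0 < n%:R / d by rewrite divr_gt0.
have b1 : expR (- (zeta ^+ 2 * (k n)%:R / 128)) <= 128 * d / (zeta ^+ 2 * n%:R).
  have y0 : 0 < zeta ^+ 2 * (n%:R / d) / 128 by rewrite divr_gt0// mulr_gt0// exprn_gt0.
  apply: le_trans (_ : expR (- (zeta ^+ 2 * (n%:R / d) / 128)) <= _).
    by rewrite ler_expR lerN2 ler_pM2r// ler_pM2l// exprn_gt0.
  apply: le_trans (expRN_le_inv y0) _.
  by rewrite le_eqVlt; apply/orP; left; apply/eqP; field; rewrite !gt_eqF.
have b2 : expR (- (k n)%:R) <= d / n%:R.
  apply: le_trans (_ : expR (- (n%:R / d)) <= _); first by rewrite ler_expR lerN2.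
  by apply: le_trans (expRN_le_inv xd) _; rewrite invf_div.
have b3 : D / n%:R <= s by rewrite ler_pdivrMr// mulrC -ler_pdivrMr.
have E3 : D / n%:R = 8 * (128 * d / (zeta ^+ 2 * n%:R)) + 2 * (d / n%:R).
  by rewrite /D; field; rewrite !gt_eqF.
rewrite E3 in b3; rewrite -/zeta in h; lra.
Unshelve. all: by end_near.
Qed.
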